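(* Let $(\mathcal{A},\mathcal{B},E,E')$ be an operator-valued infinitesimal (OVI) probability space and let $\mathcal{A}_1,\dots,\mathcal{A}_n$ be unital subalgebras of $\mathcal{A}$ that contain $\mathcal{B}$. Then the following are equivalent: (1) $\mathcal{A}_1,\dots,\mathcal{A}_n$ are infinitesimally free with respect to $(E,E')$. (2) For every $s\ge 2$, all $i_1,\dots,i_s\in\{1,\dots,n\}$ which are not all equal, and all $a_1\in\mathcal{A}_{i_1},\dots,a_s\in\mathcal{A}_{i_s}$, one has $$\kappa^{\mathcal{B}}_s(a_1,\dots,a_s)=\partial\kappa^{\mathcal{B}}_s(a_1,\dots,a_s)=0.$$
   Context: All algebras are over $\mathbb{C}$. An OVI probability space $(\mathcal{A},\mathcal{B},E,E')$ consists of a unital algebra $\mathcal{A}$, a unital subalgebra $\mathcal{B}$, a linear map $E:\mathcal{A}\to\mathcal{B}$ with $E(b)=b$ and $E(b_1ab_2)=b_1E(a)b_2$, and a linear map $E':\mathcal{A}\to\mathcal{B}$ with $E'(1)=0$ and $E'(b_1ab_2)=b_1E'(a)b_2$, for all $b,b_1,b_2\in\mathcal{B}$, $a\in\mathcal{A}$. Subalgebras $(\mathcal{A}_i)_{i\in I}$ of $\mathcal{A}$ containing $\mathcal{B}$ are infinitesimally free with respect to $(E,E')$ if for all $m\ge1$, all $i_1,\dots,i_m\in I$ with $i_1\neq i_2\neq\cdots\neq i_m$ (consecutive indices distinct) and all $a_j\in\mathcal{A}_{i_j}$ with $E(a_j)=0$, one has $E(a_1\cdots a_m)=0$ and $E'(a_1\cdots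 a_m)=\sum_{j=1}^mE(a_1\cdots a_{j-1}E'(a_j)a_{j+1}\cdots a_m)$. $NC(m)$ is the lattice of non-crossing partitions of $\{1,\dots,m\}$ ordered by refinement ($\pi\le\sigma$ if every block of $\pi$ is contained in a block of $\sigma$), $1_m$ is the one-block partition, and $\mu$ is the Möbius function of $NC(m)$. For $\pi\in NC(m)$, the multiplicative map $E_\pi:\mathcal{A}^m\to\mathcal{B}$ is obtained by applying $E$ once per block, nested according to $\pi$: $E_{1_m}(a_1,\dots,a_m)=E(a_1\cdots a_m)$, and if $V=\{l+1,\dots,l+r\}$ is an interval block of $\pi\neq 1_m$, then $E_\pi(a_1,\dots,a_m)=E_{\pi\setminus V}(a_1,\dots,a_l\,E(a_{l+1}\cdots a_{l+r}),a_{l+r+1},\dots,a_m)$ if $l\ge1$, and $E_\pi(a_1,\dots,a_m)=E(a_1\cdots a_r)\,E_{\pi\setminus V}(a_{r+1},\dots,a_m)$ if $l=0$. For a block $V\in\pi$, $\partial_VE_\pi$ is defined like $E_\pi$ except that for the block $V$ the map $E$ is replaced by $E'$; and $\partial E_\pi=\sum_{V\in\pi}\partial_VE_\pi$. For example, for $\pi=\{\{1\},\{2,5\},\{3,4\}\}$ and $V=\{2,5\}$, $\partial_VE_\pi(a_1,\dots,a_5)=E(a_1E'(a_2E(a_3a_4)a_5))$. The operator-valued free cumulants and OVI free cumulants are the multilinear maps $\mathcal{A}^m\to\mathcal{B}$ given by $\kappa^{\mathcal{B}}_m(a_1,\dots,a_m)=\sum_{\pi\in NC(m)}\mu(\pi,1_m)E_\pi(a_1,\dots,a_m)$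 and $\partial\kappa^{\mathcal{B}}_m(a_1,\dots,a_m)=\sum_{\pi\in NC(m)}\mu(\pi,1_m)\,\partial E_\pi(a_1,\dots,a_m)$. *)

(* Defs.v *)
From HB Require Import structures.
From mathcomp Require Export all_boot all_order all_algebra.
From mathcomp Require Export reals complex.
Set Implicit Arguments.
Unset Strict Implicit.
Unset Printing Implicit Defensive.
Import Order.TTheory GRing.Theory Num.Theory.
Local Open Scope ring_scope.

Definition noncrossing m (P : {set {set 'I_m}}) : bool :=
  [forall V in P, forall W in P, (V != W) ==>
    ~~ [exists a in V, exists b in W, exists c in V, exists d in W,
          [&& (a < b)%N, (b < c)%N & (c < d)%N]]].

Record NC (m : nat) := NCPartition {
  NC_blocks :> {set {set 'I_m}};
  NC_blocksP : partition NC_blocks [set: 'I_m] && noncrossing NC_blocks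
}.

HB.instance Definition _ m := [isSub for @NC_blocks m].
HB.instance Definition _ m := [Finite of NC m by <:].

Definition refines m (P Q : NC m) : bool :=
  [forall V in NC_blocks P, exists W in NC_blocks Q, V \subset W].

Lemma refines_refl m : reflexive (@refines m).
Proof.
by move=> P; apply/forall_inP => V VP; apply/exists_inP; exists V.
Qed.

Lemma refines_trans m : transitive (@refines m).
Proof.
move=> Q P S /forall_inP PQ /forall_inP QS; apply/forall_inP => V /PQ.
case/exists_inP => W /QS /exists_inP[X XS WX] VW; apply/exists_inP.
by exists X => //; apply: subset_trans WX.
Qed.

Lemma refines_anti m : antisymmetric (@refines m).
Proof.
move=> P Q /andP[PQ QP]; apply: val_inj => /=.
have sub (P1 P2 : NC m) : refines P1 P2 -> refines P2 P1 ->
    NC_blocks P1 \subset NC_blocks P2.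
  move=> /forall_inP le12 /forall_inP le21; apply/subsetP => V VP.
  have /andP[/and3P[_ tI n0] _] := NC_blocksP P1.
  have /exists_inP[W WP VW] := le12 _ VP.
  have /exists_inP[X XP WX] := le21 _ WP.
  have VX : V = X.
    apply/eqP; apply: contraNT n0 => /(trivIsetP tI _ _ VP XP).
    rewrite -setI_eq0 (setIidPl (subset_trans VW WX)) => /eqP V0.
    by rewrite -V0.
  suff -> : V = W by [].
  by apply/eqP; rewrite eqEsubset VW VX.
by apply/eqP; rewrite eqEsubset !sub.
Qed.

Fact NC_display : Order.disp_t. Proof. exact: Order.Disp tt tt. Qed.

HB.instance Definition _ m :=
  Order.Le_isPOrder.Build NC_display (NC m)
    (@refines_refl m) (@refines_anti m) (@refines_trans m).

(* Removing set0 only matters for m = 0. *)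
Lemma one_block_subproof m :
  partition ([set [set: 'I_m]] :\ set0) [set: 'I_m] &&
  noncrossing ([set [set: 'I_m]] :\ set0).
Proof.
apply/andP; split; last first.
  apply/forall_inP => V /setD1P[_ /set1P->].
  apply/forall_inP => W /setD1P[_ /set1P->].
  by rewrite eqxx.
apply/and3P; split; last by rewrite !inE eqxx.
- rewrite /cover; apply/eqP/setP => i; rewrite inE; apply/bigcupP.
  exists [set: 'I_m]; rewrite ?inE ?eqxx ?andbT //.
  by apply/set0Pn; exists i.
- apply/trivIsetP => V W /setD1P[_ /set1P->] /setD1P[_ /set1P->].
  by rewrite eqxx.
Qed.

Definition one_block m : NC m := NCPartition (one_block_subproof m).

(* mu(x, x) = 1, mu(x, y) = - \sum_(x <= z < y) mu(x, z) if x < y, and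
   mu(x, y) = 0 otherwise.  The first argument bounds the recursion depth, which
   never exceeds the number of elements of the poset. *)
Fixpoint mobius_rec d (T : finPOrderType d) (k : nat) (x y : T) : int :=
  if x == y then 1
  else if k is k'.+1 then
    - \sum_(z : T | ((x <= z) && (z < y))%O) mobius_rec k' x z
  else 0.

Definition mobius d (T : finPOrderType d) (x y : T) : int :=
  mobius_rec #|T| x y.

Section Nested.
Variables (A : nzRingType) (m : nat).
Implicit Types (P : {set {set 'I_m}}) (V : {set 'I_m}) (a : 'I_m -> A).

(* Here the ground set is cover P: positions of blocks already removed are
   skipped, the others keep their names. *)
Definition interval_block P V : bool :=
  [forall i in V, forall k in V, forall j in cover P,
     ((i < j)%N && (j < k)%N) ==> (j \in V)].

(* The last position of cover P lying to the left of V, if any. *)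
Definition left_neighbour P V : option 'I_m :=
  let D := [set l in cover P | [forall j in V, (l < j)%N]] in
  [pick l in D | [forall k in D, (k <= l)%N]].

(* Applies phi W once for each block W of P, nested according to P, by removing
   interval blocks one at a time.  For non-crossing P an interval block always
   exists, and when the maps phi W are B-bimodule maps into B the result does
   not depend on which one is picked.  The product over i in V is taken in
   increasing order of i. *)
Fixpoint nested_rec (k : nat) (phi : {set 'I_m} -> A -> A) P a : A :=
  if k is k'.+1 then
    if [pick V in P | interval_block P V] is Some V then
      let v := phi V (\prod_(i in V) a i) in
      let P' := P :\ V in
      if P' == set0 then v
      else if left_neighbour P' V is Some l then
        nested_rec k' phi P' [eta a with l |-> a l * v]
      else v * nested_rec k' phi P' a
    else 0
  else 0.

Definition nested (phi : {set 'I_m} -> A -> A) P a : A :=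
  nested_rec #|P| phi P a.

Definition E_part (E : A -> A) P a : A := nested (fun=> E) P a.

Definition dE_block (E E' : A -> A) P V a : A :=
  nested (fun W => if W == V then E' else E) P a.

Definition dE_part (E E' : A -> A) P a : A :=
  \sum_(V in P) dE_block E E' P V a.

Definition kappa (E : A -> A) a : A :=
  \sum_(P : NC m) E_part E P a *~ mobius P (one_block m).

Definition dkappa (E E' : A -> A) a : A :=
  \sum_(P : NC m) dE_part E E' P a *~ mobius P (one_block m).

End Nested.

Record OVI_space (K : fieldType) (A : algType K) (B : {pred A})
    (E E' : {linear A -> A}) : Prop := {
  OVI_subalg : GRing.subalg_closed B;
  OVI_E_in : forall a, E a \in B;
  OVI_E_id : forall b, b \in B -> E b = b;
  OVI_E_bimod : forall b1 a b2, b1 \in B -> b2 \in B ->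
    E (b1 * a * b2) = b1 * E a * b2;
  OVI_E'_in : forall a, E' a \in B;
  OVI_E'1 : E' 1 = 0;
  OVI_E'_bimod : forall b1 a b2, b1 \in B -> b2 \in B ->
    E' (b1 * a * b2) = b1 * E' a * b2
}.

Definition inf_free (A : nzRingType) (E E' : A -> A) (I : eqType)
    (As : I -> {pred A}) : Prop :=
  forall (m : nat) (i : 'I_m -> I) (a : 'I_m -> A),
    (1 <= m)%N ->
    (forall j k : 'I_m, k = j.+1 :> nat -> i j != i k) ->
    (forall j, a j \in As (i j)) ->
    (forall j, E (a j) = 0) ->
    E (\prod_(j < m) a j) = 0 /\
    E' (\prod_(j < m) a j) =
      \sum_(j < m) E (\prod_(k < m | (k < j)%N) a k * E' (a j) *
                      \prod_(k < m | (j < k)%N) a k).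

(* Main.v *)
Require Import Defs.
From HB Require Import structures.
From mathcomp Require Import all_boot all_order all_algebra.
From mathcomp Require Import reals complex.
Set Implicit Arguments.
Unset Strict Implicit.
Unset Printing Implicit Defensive.
Import Order.TTheory GRing.Theory Num.Theory.
Local Open Scope ring_scope.

(** The infinitesimal statement is the operator-valued one over dual numbers.
    Let [A + eA] be the dual numbers over [A], with [e] central and [e^2 = 0].
    The map [a + e a' |-> E a + e (E' a + E a')] is a conditional expectation of
    [A + eA] onto [B + eB].  Infinitesimal freeness of the [A_i] is freeness of
    the [A_i + e A_i] for it ([inf_free_dual]), and by a Leibniz rule its
    cumulants are [kappa(a) + e (dkappa(a) + sum_j kappa(a with a'_j at j))]
    ([dual_kappa]), so that condition (2) says that mixed cumulants of the
    [A_i + e A_i] vanish.  What remains is to prove, for a conditional expectation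
    on any ring, that freeness amounts to the vanishing of mixed cumulants.

    Vanishing implies freeness ([kappa_eq0_OV_free]).  Let [a_1, ..., a_m] be
    centred and alternating, with [m >= 2].  A non-crossing partition other than
    the one-block one has a proper interval block [W]; by induction on [m], the
    expectation of the product over [W] is [0], and the whole nested evaluation
    vanishes with it.  The cumulant is then [E(a_1 ... a_m)], and it is mixed.

    Freeness implies vanishing ([OV_free_kappa_eq0]).  Fix coloured entries [a]
    and let [k] be the Moebius transform of [P |-> E_P(a)] on [NC(m)], so that
    [E_P(a)] is the sum of the [k(Q)] for [Q <= P] and the cumulant is [k(1_m)].
    Let [V] be a block of [P], cut into its maximal monochromatic runs with
    products [x_0, ..., x_p].  Freeness gives [E(prod_j (x_j - E x_j)) = 0].
    Expanding the product and nesting the result into the other blocks of [P]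
    yields [sum_J (-1)^|J| E_(P_J)(a) = 0], where [P_J] splits [V] into the runs
    indexed by [J] and the rest ([split_relation]).  Now [Q <= P_J] means that
    [Q <= P] and that the runs in [J] are unions of blocks of [Q].  By
    inclusion-exclusion the relation becomes: the sum of the [k(Q)], over those
    [Q <= P] for which no run of [V] is a union of blocks, is [0]
    ([sum_open_runs]).  If [V] is not monochromatic then [P] is one of these [Q].
    Every other one has a non-monochromatic block, because non-crossing
    monochromatic blocks always leave some run closed ([exists_closed_run]).
    Induction along the order of [NC(m)] gives [k(P) = 0] for all [P] having a
    non-monochromatic block, in particular for [1_m] ([mobius_transform_mixed]).

    Manipulating [E_P] requires that its interval blocks may be removed in any
    order ([contract_interval]), which rests on the bimodule property. *)

(** * Moebius inversion on a finite poset *)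

(** The recursion only visits elements of the interval, so its value is fixed
    as soon as the fuel reaches the size of the interval. *)
Lemma mobius_rec_fuel d (T : finPOrderType d) (k : nat) (x y : T) :
  (#|[set z | (x <= z) && (z < y)]%O| <= k)%N ->
  mobius_rec k x y = mobius_rec #|[set z | (x <= z) && (z < y)]%O| x y.
Proof.
have [n] := ubnP k; elim: n k y => // n IHn [|k] y /ltnSE-lekn.
  by rewrite leqn0 => /eqP ->.
move=> lek; rewrite /=.
have sub z : ((x <= z) && (z < y))%O ->
    (#|[set t | (x <= t) && (t < z)]%O| < #|[set t | (x <= t) && (t < y)]%O|)%N.
  move=> /andP[xz zy]; apply: proper_card; apply/properP; split.
    apply/subsetP => t; rewrite !inE => /andP[-> tz] /=.
    exact: lt_trans zy.
  by exists z; rewrite !inE ?xz ?zy ?ltxx ?andbF.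
case Ec: #|[set z | _]| => [|c] /=.
  case: eqP => // _; rewrite big1 ?oppr0 // => z /sub.
  by rewrite Ec.
case: eqP => // _; congr (- _); apply: eq_bigr => z /sub; rewrite Ec => ltz.
have ltk : (c <= k)%N by rewrite -ltnS -Ec.
rewrite IHn //; last by apply: leq_trans ltk; rewrite -ltnS.
by rewrite [RHS]IHn // (leq_ltn_trans ltk).
Qed.

Lemma sum_mobius d (T : finPOrderType d) (x y : T) :
  \sum_(z : T | ((x <= z) && (z <= y))%O) mobius x z = (x == y)%:R.
Proof.
have fuelE z k : (#|T| <= k)%N -> mobius x z = mobius_rec k x z.
  move=> leTk; rewrite /mobius mobius_rec_fuel ?max_card // [RHS]mobius_rec_fuel //.
  exact: leq_trans (max_card _) leTk.
have [le_xy|not_le] := boolP (x <= y)%O; last first.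
  rewrite big_pred0 => [|z]; first by case: eqP not_le => // ->; rewrite lexx.
  by apply/negP => /andP[xz zy]; case/negP: not_le; apply: le_trans zy.
rewrite (bigD1 y) ?lexx ?le_xy //=.
rewrite (eq_bigl (fun z => (x <= z) && (z < y))%O); last first.
  by move=> z; rewrite lt_neqAle andbA [RHS]andbAC.
rewrite (fuelE y #|T|.+1) //=; case: eqP => [<-|_]; last by rewrite addNr.
rewrite big_pred0 ?addr0 // => z.
by apply/negP => /andP[xz /(le_lt_trans xz)]; rewrite ltxx.
Qed.

Definition mobius_transform d (T : finPOrderType d) (V : zmodType) (e : T -> V)
    (y : T) : V :=
  \sum_(x : T | (x <= y)%O) e x *~ mobius x y.

Lemma mobius_inversion d (T : finPOrderType d) (V : zmodType) (e : T -> V)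
    (y : T) :
  e y = \sum_(x : T | (x <= y)%O) mobius_transform e x.
Proof.
rewrite /mobius_transform (exchange_big_dep (fun z => z <= y)%O) /=; last first.
  by move=> x z xy /le_trans->.
rewrite (bigD1 y) //= [X in _ + X]big1 ?addr0 => [|z /andP[zy ne_zy]].
  rewrite (eq_bigl (fun x => y <= x <= y)%O) => [|x]; last by rewrite andbC.
  by rewrite -mulrz_sumr sum_mobius eqxx mulr1z.
rewrite (eq_bigl (fun x => z <= x <= y)%O) => [|x]; last by rewrite andbC.
by rewrite -mulrz_sumr sum_mobius (negPf ne_zy) mulr0z.
Qed.

(** * Intervals and ordered products *)

Section Intervals.
Variable m : nat.
Implicit Types (D V W U : {set 'I_m}) (i j k l : 'I_m).

(** The ground set [D] is a parameter: contraction removes positions, and a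
    block may become an interval of what is left. *)
Definition interval D V : bool :=
  [forall i in V, forall k in V, forall j in D,
     ((i < j)%N && (j < k)%N) ==> (j \in V)].

Definition before V l : bool := [forall j in V, (l < j)%N].

Definition left_nbr D V : option 'I_m :=
  let L := [set l in D | before V l] in
  [pick l in L | [forall k in L, (k <= l)%N]].

Lemma intervalP D V :
  reflect (forall i j k, i \in V -> k \in V -> j \in D ->
             (i < j)%N -> (j < k)%N -> j \in V)
          (interval D V).
Proof.
apply: (iffP forall_inP) => [itv i j k iV kV jD ij jk|itv i iV].
  have /forall_inP/(_ k kV)/forall_inP/(_ j jD) := itv i iV.
  by rewrite ij jk.
apply/forall_inP => k kV; apply/forall_inP => j jD; apply/implyP => /andP[].
exact: itv.
Qed.

Lemma intervalS D D' V : D' \subset D -> interval D V -> interval D' V.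
Proof.
move=> /subsetP sD /intervalP itv; apply/intervalP => i j k iV kV /sD jD.
exact: itv.
Qed.

Lemma interval_self V : interval V V.
Proof. by apply/intervalP. Qed.

Lemma interval_trans D V U :
  U \subset V -> interval D V -> interval V U -> interval D U.
Proof.
move=> /subsetP sUV /intervalP dV /intervalP vU; apply/intervalP.
move=> i j k iU kU jD ij jk; apply: (vU i j k) => //.
by apply: (dV i j k) => //; apply: sUV.
Qed.

Lemma beforeP V l : reflect (forall j, j \in V -> (l < j)%N) (before V l).
Proof. exact: forall_inP. Qed.

Lemma before_notin V l : before V l -> l \notin V.
Proof. by move=> /beforeP lV; apply/negP => /lV; rewrite ltnn. Qed.

(** A position outside an interval lies on one side of all of it. *)
Lemma interval_before D V k v :
  interval D V -> k \in D -> k \notin V -> v \in V -> (k < v)%N -> before V k.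
Proof.
move=> /intervalP itv kD kV vV kv; apply/beforeP => w wV.
have [//|wk] := ltnP k w.
have ne : w != k by apply: contraNneq kV => <-.
by case/negP: kV; apply: (itv w k v) => //; rewrite ltn_neqAle wk andbT.
Qed.

Variant left_nbr_spec D V : option 'I_m -> Type :=
| LeftNbrSome l of l \in D & before V l
    & (forall k, k \in D -> before V k -> (k <= l)%N) :
    left_nbr_spec D V (Some l)
| LeftNbrNone of (forall k, k \in D -> ~~ before V k) :
    left_nbr_spec D V None.

Lemma left_nbrP D V : left_nbr_spec D V (left_nbr D V).
Proof.
rewrite /left_nbr; case: pickP => [l /andP[]|none].
  rewrite inE => /andP[lD lV] /forall_inP lmax; constructor => // k kD kV.
  by apply: lmax; rewrite inE kD.
constructor => k kD; apply/negP => kV.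
have kL : k \in [set l in D | before V l] by rewrite inE kD.
case: (@arg_maxnP _ k [in [set l in D | before V l]] val kL) => l lL lmax.
have /negP[] := none l; rewrite inE in lL; rewrite /= inE lL /=.
by apply/forall_inP => j; apply: lmax.
Qed.

Lemma left_nbr_some D V l : l \in D -> before V l ->
  (forall k, k \in D -> before V k -> (k <= l)%N) -> left_nbr D V = Some l.
Proof.
move=> lD lV lmax; case: left_nbrP => [l' l'D l'V l'max|/(_ _ lD)/negP//].
by congr Some; apply/val_inj/anti_leq; rewrite lmax ?l'max.
Qed.

Lemma eq_left_nbr D D' V V' :
  (forall k, (k \in D) && before V k = (k \in D') && before V' k) ->
  left_nbr D V = left_nbr D' V'.
Proof.
move=> eqL; rewrite /left_nbr.
suff -> : [set l in D | before V l] = [set l in D' | before V' l] by [].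
by apply/setP => k; rewrite !inE.
Qed.

End Intervals.

Section OrderedProduct.
Variables (A : nzRingType) (m : nat).
Implicit Types (V W U : {set 'I_m}) (F G : 'I_m -> A).

Lemma sorted_enum_ord (V : {set 'I_m}) :
  sorted (fun i j : 'I_m => (i < j)%N) (enum V).
Proof.
rewrite -[sorted _ _](@sorted_map _ _ val ltn) -[enum _](eq_filter (mem_enum _)).
rewrite -(eq_filter (mem_map val_inj _)) -filter_map.
by rewrite (sorted_filter ltn_trans) // unlock val_ord_enum iota_ltn_sorted.
Qed.

Lemma prod_enum V F : \prod_(i <- enum V) F i = \prod_(i in V) F i.
Proof. by rewrite -[RHS]big_filter [index_enum _]unlock. Qed.

Lemma prod_setU V W F : (forall i j, i \in V -> j \in W -> (i < j)%N) ->
  \prod_(i in V :|: W) F i = (\prod_(i in V) F i) * (\prod_(i in W) F i).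
Proof.
move=> ltVW; rewrite -!prod_enum -big_cat; congr bigop.
apply: (@irr_sorted_eq _ (fun i j : 'I_m => (i < j)%N)).
- by move=> j i k; apply: ltn_trans.
- by move=> i; rewrite /= ltnn.
- exact: sorted_enum_ord.
- have := sorted_enum_ord V; have := sorted_enum_ord W.
  rewrite !sorted_pairwise; try by move=> j i k; apply: ltn_trans.
  move=> sW sV; rewrite pairwise_cat sW sV !andbT.
  by apply/allrelP => i j; rewrite !mem_enum; apply: ltVW.
- by move=> i; rewrite mem_cat !mem_enum inE.
Qed.

Lemma prod_max V F G v l : l \in V -> (forall i, i \in V -> (i <= l)%N) ->
  G l = F l * v -> (forall i, i \in V -> i != l -> G i = F i) ->
  \prod_(i in V) G i = (\prod_(i in V) F i) * v.
Proof.
move=> lV lmax Gl GF; rewrite -(setD1K lV) setUC !prod_setU; last 2 first.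
- move=> i j /setD1P[ne iV] /set1P->.
  by rewrite ltn_neqAle lmax // andbT; apply: contra ne => /eqP/val_inj->.
- move=> i j /setD1P[ne iV] /set1P->.
  by rewrite ltn_neqAle lmax // andbT; apply: contra ne => /eqP/val_inj->.
rewrite !big_set1 Gl mulrA; congr (_ * _ * _); apply: eq_bigr => i.
by case/setD1P => ne iV; apply: GF.
Qed.

(** Contracting an interval [U] of [V] into its left neighbour does not change
    the ordered product over [V]; without a left neighbour, the factors of [U]
    come first. *)
Lemma prod_interval V U F : U \subset V -> U != set0 -> interval V U ->
  \prod_(i in V) F i =
    if left_nbr V U is Some l then
      \prod_(i in V :\: U) (if i == l then F i * \prod_(j in U) F j else F i)
    else (\prod_(i in U) F i) * \prod_(i in V :\: U) F i.
Proof.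
move=> sUV /set0Pn[u uU] itv.
pose V1 := [set k in V | before U k].
pose V2 := [set k in V :\: U | ~~ before U k].
have lt12 i j : i \in V1 -> j \in V2 -> (i < j)%N.
  rewrite !inE -andbA => /andP[iV /beforeP iU] /and3P[jU jV].
  apply: contraR; rewrite -leqNgt => ji.
  exact: (interval_before itv jV jU uU (leq_ltn_trans ji (iU _ uU))).
have ltU2 i j : i \in U -> j \in V2 -> (i < j)%N.
  rewrite !inE -andbA => iU /and3P[jU jV].
  apply: contraR; rewrite -leqNgt => ji.
  apply: (interval_before itv jV jU iU).
  by rewrite ltn_neqAle ji andbT; apply: contraNneq jU => /val_inj->.
have lt1U i j : i \in V1 -> j \in U -> (i < j)%N.
  by rewrite !inE => /andP[_ /beforeP]; apply.
have defVU : V :\: U = V1 :|: V2.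
  apply/setP => i; rewrite !inE; case: (boolP (before U i)) => [iU|_] /=.
    by rewrite (before_notin iU) !andbT andbF orbF.
  by rewrite andbT andbF.
have defV : V = V1 :|: (U :|: V2).
  rewrite setUCA -defVU; apply/setP => i; rewrite !inE.
  by case: (boolP (i \in U)) => //= /(subsetP sUV).
have splitV : \prod_(i in V) F i =
    (\prod_(i in V1) F i) * ((\prod_(i in U) F i) * \prod_(i in V2) F i).
  rewrite [in LHS]defV !prod_setU // => i j i1; rewrite inE.
  by case/orP; [apply: lt1U|apply: lt12].
rewrite splitV defVU; case: left_nbrP => [l lV lU lmax|none]; last first.
  rewrite prod_setU // (_ : V1 = set0) ?big_set0 ?mul1r //.
  by apply/setP => i; rewrite !inE; apply/negP => /andP[/none/negP].
have l1 : l \in V1 by rewrite inE lV.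
rewrite prod_setU //; rewrite mulrA; congr (_ * _).
  rewrite [RHS](@prod_max V1 F _ (\prod_(j in U) F j) l) ?eqxx //.
    by move=> i; rewrite inE => /andP[]; apply: lmax.
  by move=> i _ /negPf->.
apply: eq_bigr => i i2; case: eqP => // ii; move: (lt12 _ _ l1 i2).
by rewrite ii ltnn.
Qed.

End OrderedProduct.

Section ProdSplit.
Variables (A : nzRingType) (m : nat).
Implicit Types (V : {set 'I_m}) (F G H : 'I_m -> A).

Lemma prod_at V F i : i \in V ->
  \prod_(k in V) F k =
    (\prod_(k in V | (k < i)%N) F k) * F i * \prod_(k in V | (i < k)%N) F k.
Proof.
move=> iV; pose L := [set k in V | (k < i)%N]; pose R := [set k in V | (i < k)%N].
have -> : V = L :|: ([set i] :|: R).
  apply/setP => k; rewrite !inE -val_eqE /=.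
  by case: ltngtP => [||/val_inj->]; rewrite ?andbT ?andbF ?orbF // iV.
rewrite !prod_setU ?big_set1 ?mulrA.
- congr (_ * _ * _); apply: eq_bigl => k; rewrite !inE -val_eqE /=.
    by case: ltngtP; rewrite ?andbT ?andbF ?orbF.
  by case: ltngtP; rewrite ?andbT ?andbF ?orbF.
- by move=> j k; rewrite !inE => /eqP-> /andP[].
- move=> j k; rewrite !inE => /andP[_ ji] /orP[/eqP->//|/andP[_ ik]].
  exact: ltn_trans ik.
Qed.

Lemma prod_updB V F G H i : i \in V -> F i = G i - H i ->
  (forall k, k != i -> F k = G k) -> (forall k, k != i -> H k = G k) ->
  \prod_(k in V) F k = \prod_(k in V) G k - \prod_(k in V) H k.
Proof.
move=> iV Fi FG HG; rewrite !(prod_at _ iV) Fi mulrBr mulrBl.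
have ne (k : 'I_m) : (k < i)%N || (i < k)%N -> k != i by rewrite -neq_ltn.
by congr (_ * _ * _ - _ * _ * _); apply: eq_bigr => k /andP[_ ki];
   rewrite ?FG ?HG // ne // ki ?orbT.
Qed.

End ProdSplit.

(** * Non-crossing families of blocks *)

Section Families.
Variable m : nat.
Implicit Types (P Q : {set {set 'I_m}}) (D V W U X Y : {set 'I_m}).

Definition ncfamily P : bool := [&& trivIset P, set0 \notin P & noncrossing P].

Lemma noncrossingP P :
  reflect (forall V W, V \in P -> W \in P -> V != W ->
             forall a b c d : 'I_m, a \in V -> b \in W -> c \in V -> d \in W ->
             (a < b)%N -> (b < c)%N -> (c < d)%N -> False)
          (noncrossing P).
Proof.
apply: (iffP forall_inP) => [nc V W VP WP neVW a b c d aV bW cV dW ab bc cd|nc].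
  have /forall_inP/(_ W WP)/implyP/(_ neVW)/negP := nc V VP; apply.
  apply/exists_inP; exists a => //; apply/exists_inP; exists b => //.
  apply/exists_inP; exists c => //; apply/exists_inP; exists d => //.
  by rewrite ab bc cd.
move=> V VP; apply/forall_inP => W WP; apply/implyP => neVW; apply/negP.
case/exists_inP => a aV /exists_inP[b bW] /exists_inP[c cV] /exists_inP[d dW].
by case/and3P => ab bc cd; apply: (nc V W VP WP neVW a b c d).
Qed.

Lemma ncfamily_disjoint P V W i :
  ncfamily P -> V \in P -> W \in P -> i \in V -> i \in W -> V = W.
Proof.
case/and3P => /trivIsetP tI _ _ VP WP iV iW; apply/eqP.
apply: contraTT isT => /(tI _ _ VP WP); rewrite -setI_eq0 => /eqP/setP/(_ i).
by rewrite !inE iV iW.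
Qed.

Lemma ncfamily_set0 P V : ncfamily P -> V \in P -> V != set0.
Proof. by case/and3P => _ n0 _ VP; apply: contraNneq n0 => <-. Qed.

Lemma ncfamilyS P Q : Q \subset P -> ncfamily P -> ncfamily Q.
Proof.
move=> sQP /and3P[tI n0 /noncrossingP nc]; have /subsetP sub := sQP.
apply/and3P; split; first exact: trivIsetS sQP tI.
- by apply: contra n0; apply: sub.
- by apply/noncrossingP => V W /sub VP /sub WP; apply: nc.
Qed.

Lemma ncfamilyD1 P V : ncfamily P -> ncfamily (P :\ V).
Proof. exact/ncfamilyS/subD1set. Qed.

Lemma mem_cover P V i : V \in P -> i \in V -> i \in cover P.
Proof. by move=> VP iV; apply/bigcupP; exists V. Qed.

Lemma cardS_D1 P V : V \in P -> #|P| = #|P :\ V|.+1.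
Proof. by move=> VP; rewrite (cardsD1 V) VP. Qed.

Lemma cover_D1 P V : ncfamily P -> V \in P -> cover (P :\ V) = cover P :\: V.
Proof.
move=> ncP VP; apply/setP => i; rewrite inE; apply/bigcupP/andP.
  case=> W /setD1P[neWV WP] iW; split; last exact: mem_cover iW.
  apply: contraNN neWV => iV; apply/eqP.
  exact: ncfamily_disjoint ncP _ _ iW iV.
by case=> niV /bigcupP[W WP iW]; exists W => //; rewrite !inE WP andbT;
   apply: contraNneq niV => <-.
Qed.

(** A block of minimal span has no room for a smaller one inside, so it is an
    interval. *)
Lemma interval_exists P : ncfamily P -> P != set0 ->
  exists2 V, V \in P & interval (cover P) V.
Proof.
move=> ncP /set0Pn[V0 V0P].
pose span V := [set t : 'I_m | [exists i in V, i <= t]%N && [exists k in V, t <= k]%N].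
case: (@arg_minnP _ V0 [in P] (fun V => #|span V|) V0P) => V VP minV.
exists V => //; apply/intervalP => i j k iV kV jP ij jk.
apply: contraT => njV; have /bigcupP[W WP jW] := jP.
have neVW : V != W by apply: contraNneq njV => ->.
have /and3P[_ _ /noncrossingP nc] := ncP.
(* A block W entering the gap between i and k of V cannot leave it. *)
have disj w : w \in W -> w \in V -> False.
  move=> wW wV; case/eqP: neVW; exact: ncfamily_disjoint ncP VP WP wV wW.
have inside w : w \in W -> (i < w)%N && (w < k)%N.
  move=> wW; apply/andP; split.
    rewrite ltnNge leq_eqVlt; apply/negP => /orP[/eqP/val_inj ew|wi].
      by apply: (disj w) => //; rewrite ew.
    have neWV : W != V by rewrite eq_sym.
    exact: (nc W V WP VP neWV w i j k).
  rewrite ltnNge leq_eqVlt; apply/negP => /orP[/eqP/val_inj ew|kw].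
    by apply: (disj w) => //; rewrite -ew.
  exact: (nc V W VP WP neVW i j k w).
have: (#|span W| < #|span V|)%N.
  apply: proper_card; apply/properP; split.
    apply/subsetP => t; rewrite !inE => /andP[/exists_inP[w wW wt]].
    case/exists_inP => w' w'W tw'; apply/andP; split; apply/exists_inP.
      by exists i => //; have /andP[/ltnW iw _] := inside w wW; apply: leq_trans wt.
    exists k => //; have /andP[_ /ltnW w'k] := inside w' w'W.
    exact: leq_trans w'k.
  exists i.
    by rewrite inE; apply/andP; split; apply/exists_inP; exists i.
  rewrite inE; apply/nandP; left; apply/exists_inP => -[w wW wi].
  by have /andP[] := inside w wW; rewrite ltnNge wi.
by rewrite ltnNge minV.
Qed.

End Families.

(** * Nested evaluation *)

Record OV_space (A : nzRingType) (B : {pred A}) (E : {additive A -> A}) :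
    Prop := {
  OV_one : 1 \in B;
  OV_in : forall a, E a \in B;
  OV_id : forall b, b \in B -> E b = b;
  OV_bimod : forall b1 a b2, b1 \in B -> b2 \in B ->
    E (b1 * a * b2) = b1 * E a * b2
}.

Section Bimodule.
Variables (A : nzRingType) (B : {pred A}) (E : {additive A -> A}).
Hypothesis hE : OV_space B E.

Lemma OV_mulr a b : b \in B -> E (a * b) = E a * b.
Proof.
by move=> bB; have := OV_bimod hE a (OV_one hE) bB; rewrite !mul1r.
Qed.

Lemma OV_mull a b : b \in B -> E (b * a) = b * E a.
Proof.
by move=> bB; have := OV_bimod hE a bB (OV_one hE); rewrite !mulr1.
Qed.

Lemma OV_idem a : E (E a) = E a.
Proof. exact/(OV_id hE)/(OV_in hE). Qed.

End Bimodule.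

Section Contract.
Variables (A : nzRingType) (m : nat).
Implicit Types (P : {set {set 'I_m}}) (D V W : {set 'I_m}) (l o : option 'I_m).

(** The word being contracted.  The coordinate [None] is a virtual leftmost
    position: it receives the values of blocks without left neighbour, and the
    final result is read there. *)
Definition state := {ffun option 'I_m -> A}.
Implicit Types f : state.

Definition inside V o : bool := if o is Some i then i \in V else false.

Definition upd f o (x : A) : state := [ffun o' => if o' == o then x else f o'].

(** The positions of the removed block are reset, so that a state keeps no trace
    of the blocks already removed besides their values. *)
Definition step (E : A -> A) D V f : state :=
  [ffun o => if inside V o then 0
             else if o == left_nbr D V
                  then f o * E (\prod_(i in V) f (Some i))
             else f o].

Definition word (a : 'I_m -> A) : state := [ffun o => oapp a 1 o].

(** Allowing a different map for each block covers [dE_block] as well. *)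
Fixpoint contract_by (phi : {set 'I_m} -> A -> A) (k : nat) P f : A :=
  if k is k'.+1 then
    if [pick V in P | interval_block P V] is Some V then
      contract_by phi k' (P :\ V) (step (phi V) (cover P) V f)
    else f None
  else f None.

Lemma left_nbr_inside D V l : left_nbr D V = l -> ~~ inside V l.
Proof. by move=> <-; case: left_nbrP => // l' _ /before_notin. Qed.

Lemma contract_set0 phi k f : contract_by phi k set0 f = f None.
Proof. by case: k => //= k; case: pickP => // V; rewrite inE. Qed.

End Contract.

Notation contract E := (contract_by (fun=> E)).

Section ContractTheory.
Variables (A : nzRingType) (B : {pred A}) (E : {additive A -> A}) (m : nat).
Hypothesis hE : OV_space B E.
Implicit Types (P : {set {set 'I_m}}) (D V W : {set 'I_m}) (o : option 'I_m).
Implicit Types f : state A m.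

(** If the left neighbour of [W] is outside [V], the two removals act on
    different coordinates.  Otherwise it is the last position of [V]; removing [W]
    first multiplies the word of [V] by [E w] on the right, which leaves [E] by
    right linearity, and both orders send [E v * E w] to the left neighbour of
    [V]. *)
Lemma step_commute_ordered D V W f :
  V \subset D -> V != set0 -> W != set0 ->
  interval D V -> interval D W ->
  (forall v w, v \in V -> w \in W -> (v < w)%N) ->
  step E (D :\: V) W (step E D V f) = step E (D :\: W) V (step E D W f).
Proof.
move=> /subsetP sVD /set0Pn[v0 v0V] /set0Pn[w0 w0W] itV itW ltVW.
have notVW i : i \in V -> i \in W -> False.
  by move=> iV iW; have := ltVW _ _ iV iW; rewrite ltnn.
have befW v : v \in V -> before W v by move=> vV; apply/beforeP => w; apply: ltVW.
have befVW k : before V k -> before W k.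
  move=> /beforeP kV; apply/beforeP => w wW.
  exact: ltn_trans (kV _ v0V) (ltVW _ _ v0V wW).
have lV : left_nbr (D :\: W) V = left_nbr D V.
  apply: eq_left_nbr => k; rewrite inE; case: (boolP (before V k)) => [kV|].
    by rewrite (before_notin (befVW _ kV)).
  by rewrite !andbF.
have notWl : inside W (left_nbr D V) = false.
  by case: left_nbrP => // k _ kV _; apply/negbTE/before_notin/befVW.
have prodW : \prod_(i in W) step E D V f (Some i) = \prod_(i in W) f (Some i).
  apply: eq_bigr => i iW; rewrite ffunE /=.
  case: ifP => [iV|_]; first by case: (notVW i).
  case: left_nbrP => [l _ /beforeP lV' _|_]; last by case: eqP.
  case: eqP => // -[il]; have := lV' _ v0V; rewrite -il => iv.
  by have := ltn_trans iv (ltVW _ _ v0V iW); rewrite ltnn.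
case eW: (left_nbr D W) / (left_nbrP D W) => [l lD lW lmax|none]; last first.
  by have := none v0 (sVD _ v0V); rewrite befW.
have maxl v : v \in V -> (v <= l)%N by move=> vV; rewrite lmax ?sVD ?befW.
have [l_in|l_out] := boolP (l \in V).
  have lW' : left_nbr (D :\: V) W = left_nbr D V.
    apply: eq_left_nbr => k; rewrite inE.
    apply/andP/andP => [[/andP[kV kD] kW]|[kD kV]].
      split=> //; apply: (interval_before itV kD kV l_in).
      rewrite ltn_neqAle lmax // andbT.
      by apply: contraNneq kV => /val_inj->.
    by rewrite kD (before_notin kV) (befVW _ kV).
  have prodV : \prod_(i in V) step E D W f (Some i) =
      (\prod_(i in V) f (Some i)) * E (\prod_(i in W) f (Some i)).
    apply: (prod_max l_in maxl).
      rewrite ffunE /= eW eqxx ifF //.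
      by apply/negP => /(notVW _ l_in).
    move=> i iV ne; rewrite ffunE /= eW ifF ?(inj_eq Some_inj) ?(negPf ne) //.
    by apply/negP => /(notVW _ iV).
  apply/ffunP => o; rewrite ffunE lW' prodW [RHS]ffunE lV prodV.
  rewrite (OV_mulr hE) ?(OV_in hE) // mulrA.
  case: (boolP (inside W o)) => [oW|oW].
    case: (boolP (inside V o)) => // oV.
    have oV' : o == left_nbr D V = false.
      case: o oW {oV} => //= i iW; case: left_nbrP => // k _ kV _.
      apply/eqP => -[ik]; have := before_notin (befVW _ kV).
      by rewrite -ik iW.
    by rewrite oV' ffunE oW.
  have [->|neo] := eqVneq o (left_nbr D V).
    rewrite (negPf (left_nbr_inside erefl)) [in LHS]ffunE eqxx.
    rewrite (negPf (left_nbr_inside erefl)) [in RHS]ffunE.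
    rewrite notWl eW ifF //; apply/negbTE; apply: contraTneq l_in => ll.
    by have := @left_nbr_inside _ D V _ ll.
  rewrite ffunE (negPf neo); case: ifP => // oV; rewrite ffunE (negPf oW) eW ifF //.
  by apply: contraFF oV => /eqP->.
have lW' : left_nbr (D :\: V) W = Some l.
  by apply: left_nbr_some => [||k]; rewrite ?inE ?l_out // => /andP[_]; apply: lmax.
have prodV : \prod_(i in V) step E D W f (Some i) = \prod_(i in V) f (Some i).
  apply: eq_bigr => i iV; rewrite ffunE /= eW ifF ?ifF //.
    by apply/eqP => -[il]; rewrite -il iV in l_out.
  by apply/negP => /(notVW _ iV).
have l_ne : Some l == left_nbr D V = false.
  apply/eqP; case: left_nbrP => // k _ kV _ [lk].
  by have := maxl v0 v0V; rewrite leqNgt lk (beforeP _ _ kV).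
apply/ffunP => o; rewrite ffunE lW' prodW [RHS]ffunE lV prodV.
rewrite [step E D V f o]ffunE [step E D W f o]ffunE eW.
have [->|neo] := eqVneq o (Some l).
  by rewrite l_ne /= (negPf l_out) (negPf (before_notin lW)).
have [->|neo'] := eqVneq o (left_nbr D V); last by case: ifP; case: ifP.
by rewrite (negPf (left_nbr_inside erefl)) notWl.
Qed.

Lemma interval_ordered D V W v w :
  V \subset D -> W \subset D -> [disjoint V & W] ->
  interval D V -> interval D W -> v \in V -> w \in W -> (v < w)%N ->
  forall v' w', v' \in V -> w' \in W -> (v' < w')%N.
Proof.
move=> /subsetP sVD /subsetP sWD; rewrite -setI_eq0 => /eqP/setP dVW itV itW.
have notVW i : i \in V -> i \in W -> False.
  by move=> iV iW; have := dVW i; rewrite !inE iV iW.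
move=> vV wW vw v' w' v'V w'W.
have vw' : (v < w')%N.
  have vW : v \notin W by apply/negP => /(notVW _ vV).
  by have /beforeP := interval_before itW (sVD _ vV) vW wW vw; apply.
rewrite ltnNge leq_eqVlt; apply/negP => /orP[/eqP/val_inj ew|w'v'].
  by case: (notVW v') => //; rewrite -ew.
apply: (notVW w') => //; move/intervalP: itV.
by move=> /(_ v w' v' vV v'V (sWD _ w'W) vw' w'v').
Qed.

Lemma step_commute D V W f :
  V \subset D -> W \subset D -> [disjoint V & W] -> V != set0 -> W != set0 ->
  interval D V -> interval D W ->
  step E (D :\: V) W (step E D V f) = step E (D :\: W) V (step E D W f).
Proof.
move=> sVD sWD dVW n0V n0W itV itW.
have [[v vV] [w wW]] := (set0Pn _ n0V, set0Pn _ n0W).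
case: (ltngtP v w) => [vw|wv|/val_inj evw].
- apply: step_commute_ordered => //; exact: (@interval_ordered D V W v w).
- apply/esym/step_commute_ordered => //.
  by apply: (@interval_ordered D W V w v) => //; rewrite disjoint_sym.
- by have /pred0P/(_ v) := dVW; rewrite /= vV evw wW.
Qed.

(** By [step_commute], the interval block picked by the recursion may be
    exchanged with any other one. *)
Lemma contract_interval P V f :
  ncfamily P -> V \in P -> interval (cover P) V ->
  contract E #|P| P f = contract E #|P :\ V| (P :\ V) (step E (cover P) V f).
Proof.
have [n] := ubnP #|P|; elim: n P V f => // n IHn P V f /ltnSE-leP ncP VP itV.
rewrite {1}(cardS_D1 VP) /=; case: pickP => [W|/(_ V)]; last first.
  by rewrite VP /= => /negP/(_ itV).
case/andP => WP itW; have [<-|neWV] := eqVneq W V.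
  by [].
have eqc : #|P :\ V| = #|P :\ W|.
  by apply: succn_inj; rewrite -!cardS_D1.
have ltc X : X \in P -> (#|P :\ X| < n)%N.
  by move=> XP; rewrite -cardS_D1.
have VPW : V \in P :\ W by rewrite !inE eq_sym neWV.
have WPV : W \in P :\ V by rewrite !inE neWV.
have cP X Y : X \in P -> interval (cover P) Y -> interval (cover (P :\ X)) Y.
  by move=> XP; apply: intervalS; rewrite (cover_D1 ncP) // subsetDl.
have ncD X := ncfamilyD1 X ncP.
rewrite [in LHS]eqc (IHn _ V _ (ltc W WP) (ncD W) VPW (cP W V WP itV)).
rewrite (IHn _ W _ (ltc V VP) (ncD V) WPV (cP V W VP itW)).
have -> : P :\ V :\ W = P :\ W :\ V by rewrite !setDDl setUC.
rewrite !(cover_D1 ncP) // step_commute ?(ncfamily_set0 ncP) //.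
- exact: bigcup_sup.
- exact: bigcup_sup.
- by have /and3P[/trivIsetP tI _ _] := ncP; apply: tI => //; rewrite eq_sym.
Qed.

End ContractTheory.

Section Multilinear.
Variables (A : nzRingType) (B : {pred A}) (E : {additive A -> A}) (m : nat).
Hypothesis hE : OV_space B E.
Implicit Types (P : {set {set 'I_m}}) (D V W : {set 'I_m}) (o : option 'I_m).
Implicit Types f : state A m.

Definition live P o := if o is Some i then i \in cover P else true.

(** Removing a block turns a dependence on one coordinate into a dependence on
    one coordinate, through an additive map. *)
Lemma step_upd P V f o : ncfamily P -> V \in P -> live P o ->
  exists o' f' (phi : A -> A), [/\ live (P :\ V) o', {morph phi : x y / x - y}
    & forall x, step E (cover P) V (upd f o x) = upd f' o' (phi x)].
Proof.
move=> ncP VP lo; set l := left_nbr (cover P) V.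
have ll : live (P :\ V) l.
  rewrite /l; case: left_nbrP => //= k kP kV _.
  by rewrite cover_D1 // inE kP before_notin.
have nlV : ~~ inside V l by apply: left_nbr_inside.
have [oV|noV] := boolP (inside V o).
  exists l, (step E (cover P) V f),
    (fun x => f l * E (\prod_(i in V) upd f o x (Some i))); split=> // [x y|x].
    rewrite -mulrBr -raddfB; congr (_ * E _).
    case: o oV {lo} => // i iV; apply: (prod_updB iV); rewrite ?ffunE ?eqxx //.
      by move=> k ne; rewrite !ffunE (inj_eq Some_inj) (negPf ne).
    by move=> k ne; rewrite !ffunE (inj_eq Some_inj) (negPf ne).
  apply/ffunP => o'; rewrite !ffunE -/l; have [->|ne] := eqVneq o' l.
    by rewrite (negPf nlV) ifF //; apply: contraNF nlV => /eqP->.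
  by case: ifP => // oV'; rewrite ifF //; apply: contraFF oV' => /eqP->.
have prodV x : \prod_(i in V) upd f o x (Some i) = \prod_(i in V) f (Some i).
  apply: eq_bigr => i iV; rewrite ffunE ifF //.
  by apply: contraNF noV => /eqP<-.
exists o, (step E (cover P) V f),
  (fun x => if o == l then x * E (\prod_(i in V) f (Some i)) else x); split.
- by case: o lo noV {prodV} => //= i iP niV; rewrite cover_D1 // inE niV.
- by move=> x y; case: ifP => // _; rewrite mulrBl.
move=> x; apply/ffunP => o'; rewrite !ffunE -/l prodV.
have [->|ne] := eqVneq o' o; last by [].
by rewrite (negPf noV).
Qed.

Lemma contract_updB P f o x y : ncfamily P -> live P o ->
  contract E #|P| P (upd f o (x - y)) =
  contract E #|P| P (upd f o x) - contract E #|P| P (upd f o y).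
Proof.
have [n] := ubnP #|P|; elim: n P f o x y => // n IHn P f o x y /ltnSE-leP ncP lo.
have [P0|P0] := eqVneq P set0.
  move: lo; rewrite P0 !contract_set0 !ffunE.
  case: o => [i|_]; last by rewrite eqxx.
  by rewrite /= /cover big_set0 inE.
have [V VP itV] := interval_exists ncP P0.
have [o' [f' [phi [lo' phiB stepE]]]] := step_upd f ncP VP lo.
rewrite !(contract_interval hE _ ncP VP itV) !stepE phiB IHn //.
  by rewrite -(cardS_D1 VP).
exact: ncfamilyD1.
Qed.

Lemma contract_upd0 P f o : ncfamily P -> live P o ->
  contract E #|P| P (upd f o 0) = 0.
Proof. by move=> ncP lo; have := contract_updB f 0 0 ncP lo; rewrite !subrr. Qed.

Lemma contract_upd_signed_sum (I : finType) (d : I -> nat) (x : I -> A) P f o :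
  ncfamily P -> live P o ->
  contract E #|P| P (upd f o (\sum_i (-1) ^+ d i * x i)) =
  \sum_i (-1) ^+ d i * contract E #|P| P (upd f o (x i)).
Proof.
move=> ncP lo; set h := fun y => contract E #|P| P (upd f o y).
have h0 : h 0 = 0 by apply: contract_upd0.
have hN y : h (- y) = - h y by rewrite -sub0r /h contract_updB // -/(h 0) h0 sub0r.
have hD y z : h (y + z) = h y + h z.
  by rewrite -[z in LHS]opprK /h contract_updB // -/(h (- z)) hN opprK.
rewrite -/(h _) (big_morph h hD h0); apply: eq_bigr => i _.
rewrite -signr_odd; case: (odd _); last by rewrite expr0 !mul1r.
by rewrite expr1 !mulN1r hN.
Qed.

End Multilinear.

(** The recursion of [nested] treats apart the blocks without left neighbour and
    the last block; the coordinate [None] makes these cases uniform, at the price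
    of a prefix. *)
Lemma nested_contract (A : nzRingType) m (phi : {set 'I_m} -> A -> A)
    (P : {set {set 'I_m}}) (f : state A m) (a : 'I_m -> A) : ncfamily P -> P != set0 ->
  (forall i, i \in cover P -> f (Some i) = a i) ->
  f None * nested phi P a = contract_by phi #|P| P f.
Proof.
rewrite /nested; have [n] := ubnP #|P|.
elim: n P f a => // n IHn P f a /ltnSE-leP ncP P0 fa.
have [V VP itV] := interval_exists ncP P0.
rewrite {1}(cardS_D1 VP) [in RHS](cardS_D1 VP) /=.
case: pickP => [W /andP[WP _]|/(_ V)]; last by rewrite VP /= => /negP/(_ itV).
have -> : #|P :\ V| = #|P :\ W| by apply: succn_inj; rewrite -!cardS_D1.
have leW : (#|P :\ W| < n)%N by rewrite -cardS_D1.
have prodW : \prod_(i in W) f (Some i) = \prod_(i in W) a i.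
  by apply: eq_bigr => i iW; apply: fa; apply: mem_cover iW.
have W0 := ncfamily_set0 ncP WP.
have lnE : left_neighbour (P :\ W) W = left_nbr (cover P) W.
  apply: (@eq_left_nbr _ (cover (P :\ W)) _ W W) => k; rewrite cover_D1 // inE.
  by have [/before_notin->|] := boolP (before W k); rewrite ?andbF.
have coverW i : i \in cover (P :\ W) -> (i \in cover P) /\ (i \notin W).
  by rewrite cover_D1 // inE => /andP[].
have [PW0|PW0] := eqVneq (P :\ W) set0.
  rewrite PW0 contract_set0 // ffunE /= prodW.
  case: left_nbrP => [l lP lW _|//]; have := cover_D1 ncP WP.
  by rewrite PW0 /cover big_set0 => /setP/(_ l); rewrite !inE lP before_notin.
rewrite lnE; case eL: left_nbr => [l|].
  rewrite -(IHn _ _ [eta a with l |-> a l * phi W (\prod_(i in W) a i)]) //.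
  - by rewrite ffunE /= eL.
  - exact: ncfamilyD1.
  move=> i /coverW[iP niW]; rewrite ffunE /= (negPf niW) eL (inj_eq Some_inj).
  by rewrite prodW fa //; case: eqP => // ->.
rewrite -(IHn _ _ a) //; first by rewrite ffunE /= eL prodW mulrA.
  exact: ncfamilyD1.
by move=> i /coverW[iP niW]; rewrite ffunE /= (negPf niW) eL fa.
Qed.

(** The block picked depends on the family alone, so evaluations over different
    rings and with different maps can be unfolded in parallel. *)
Lemma contract_by_pick m (P : {set {set 'I_m}}) : ncfamily P -> P != set0 ->
  exists2 W, W \in P & forall (A : nzRingType) (phi : {set 'I_m} -> A -> A) f,
    contract_by phi #|P| P f =
    contract_by phi #|P :\ W| (P :\ W) (step (phi W) (cover P) W f).
Proof.
move=> ncP P0; have [V VP itV] := interval_exists ncP P0.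
case eW: [pick V in P | interval_block P V] => [W|]; last first.
  by move: eW; case: pickP => // /(_ V); rewrite VP /= => /negP/(_ itV).
have WP : W \in P by move: eW; case: pickP => // X /andP[XP _] [<-].
by exists W => // A phi f; rewrite (cardS_D1 WP) /= eW.
Qed.

Lemma contract_by_ext m (A : nzRingType) (phi psi : {set 'I_m} -> A -> A) k
    (P : {set {set 'I_m}}) f : {in P, phi =1 psi} ->
  contract_by phi k P f = contract_by psi k P f.
Proof.
elim: k P f => //= k IHk P f eq_phi; case: pickP => // V /andP[VP _].
rewrite IHk; last by move=> W /setD1P[_ WP]; apply: eq_phi.
by congr contract_by; apply/ffunP => o; rewrite !ffunE eq_phi.
Qed.

(** * Splitting a block into intervals *)

Section Split.
Variable m : nat.
Implicit Types (P Us : {set {set 'I_m}}) (D V W U X Y : {set 'I_m}).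

Definition pieces V Us : Prop :=
  [/\ trivIset Us, set0 \notin Us & forall U, U \in Us -> U \subset V /\ interval V U].

(** Here [P] stands for the blocks other than [V]; when [Us] covers [V], no
    remainder is left. *)
Definition split_block P V Us : {set {set 'I_m}} :=
  P :|: Us :|: ([set V :\: cover Us] :\ set0).

Lemma pieces_disjoint V Us U X i :
  pieces V Us -> U \in Us -> X \in Us -> i \in U -> i \in X -> U = X.
Proof.
case=> /trivIsetP tI _ _ UUs XUs iU iX; apply/eqP; apply: contraTT iX => ne.
by have /pred0P/(_ i) := tI _ _ UUs XUs ne; rewrite /= iU /= => ->.
Qed.

Lemma split_blockP P V Us X : X \in split_block P V Us ->
  [\/ X \in P, X \in Us | X = V :\: cover Us /\ X != set0].
Proof.
rewrite !inE => /orP[/orP[XP|XU]|/andP[X0 /eqP XE]].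
- exact: Or31.
- exact: Or32.
- by apply: Or33.
Qed.

Lemma cover_split_block P V Us : pieces V Us ->
  cover (split_block P V Us) = cover P :|: V.
Proof.
case=> _ _ sUV; apply/setP => i; rewrite inE; apply/bigcupP/idP.
  case=> X /split_blockP[XP|/sUV[/subsetP sXV _]|[-> _]] iX.
  - by rewrite (mem_cover XP iX).
  - by rewrite sXV ?orbT.
  - by move: iX; rewrite inE => /andP[_ ->]; rewrite orbT.
case/orP => [/bigcupP[X XP iX]|iV]; first by exists X => //; rewrite !inE XP.
have [/bigcupP[X XU iX]|niU] := boolP (i \in cover Us).
  by exists X => //; rewrite !inE XU orbT.
have iR : i \in V :\: cover Us by rewrite inE niU.
by exists (V :\: cover Us) => //; rewrite !inE eqxx andbT;
   apply/orP; right; apply/set0Pn; exists i.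
Qed.

(** A crossing involving only one part of [V] is a crossing with [V].  Two parts
    of [V] do not cross because one of them is an interval of [V]. *)
Lemma ncfamily_split P V Us : V \notin P -> ncfamily (V |: P) -> pieces V Us ->
  ncfamily (split_block P V Us).
Proof.
move=> VP ncV pUs; have [tU U0 sUV] := pUs.
have old X : X \in P -> X \in V |: P by rewrite !inE => ->; rewrite orbT.
have VV : V \in V |: P by rewrite !inE eqxx.
have VnX X : X \in P -> V != X by apply: contraTneq => <-.
have kind X : X \in split_block P V Us -> X \in P \/ X \subset V.
  case/split_blockP => [|/sUV[]|[-> _]]; [by left|by right|right].
  exact: subsetDl.
have piece X Y i : X \notin P -> Y \notin P ->
    X \in split_block P V Us -> Y \in split_block P V Us ->
    i \in X -> i \in Y -> X = Y.
  move=> XP YP XQ YQ iX iY.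
  case/split_blockP: XQ => [/(negP XP)//|XU|[XE _]];
  case/split_blockP: YQ => [/(negP YP)//|YU|[YE _]].
  - exact: pieces_disjoint pUs XU YU iX iY.
  - by move: iY; rewrite YE inE (mem_cover XU iX).
  - by move: iX; rewrite XE inE (mem_cover YU iY).
  - by rewrite XE YE.
have disj X Y i : X \in split_block P V Us -> Y \in split_block P V Us ->
    i \in X -> i \in Y -> X = Y.
  move=> XQ YQ iX iY.
  have [XP|XP] := boolP (X \in P); have [YP|YP] := boolP (Y \in P).
  - exact: ncfamily_disjoint ncV (old _ XP) (old _ YP) iX iY.
  - have [/(negP YP)//|/subsetP sYV] := kind _ YQ.
    have := ncfamily_disjoint ncV VV (old _ XP) (sYV _ iY) iX.
    by move=> eqV; case/eqP: (VnX _ XP).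
  - have [/(negP XP)//|/subsetP sXV] := kind _ XQ.
    have := ncfamily_disjoint ncV VV (old _ YP) (sXV _ iX) iY.
    by move=> eqV; case/eqP: (VnX _ YP).
  have [/(negP XP)//|sX] := kind _ XQ; have [/(negP YP)//|sY] := kind _ YQ.
  exact: piece iX iY.
apply/and3P; split.
- apply/trivIsetP => X Y XQ YQ neXY; apply/pred0P => i /=; apply/negP.
  by case/andP => iX iY; case/eqP: neXY; apply: disj iX iY.
- apply/negP => /split_blockP[|/(negP U0)//|[_ /eqP//]] P0.
  by have /and3P[_ /negP[]] := ncV; apply: old.
have /and3P[_ _ /noncrossingP nc] := ncV.
apply/noncrossingP => X Y XQ YQ neXY a b c d aX bY cX dY ab bc cd.
have nXY i : i \in X -> i \in Y -> False.
  by move=> iX iY; case/eqP: neXY; apply: disj iX iY.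
have [XP|XP] := boolP (X \in P); have [YP|YP] := boolP (Y \in P).
- exact: (nc X Y (old _ XP) (old _ YP) neXY a b c d).
- have [/(negP YP)//|/subsetP sYV] := kind _ YQ.
  apply: (nc X V (old _ XP) VV _ a b c d) => //; try exact: sYV.
  by rewrite eq_sym VnX.
- have [/(negP XP)//|/subsetP sXV] := kind _ XQ.
  by apply: (nc V Y VV (old _ YP) (VnX _ YP) a b c d) => //; apply: sXV.
have [/(negP XP)//|/subsetP sX] := kind _ XQ.
have [/(negP YP)//|/subsetP sY] := kind _ YQ.
case/split_blockP: (XQ) => [/(negP XP)//|/sUV[_ /intervalP itX]|[XE _]].
  by apply: (nXY b) => //; apply: (itX a b c) => //; apply: sY.
case/split_blockP: (YQ) => [/(negP YP)//|/sUV[_ /intervalP itY]|[YE _]].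
  by apply: (nXY c) => //; apply: (itY b c d) => //; apply: sX.
by case/eqP: neXY; rewrite XE YE.
Qed.

(** Crossings and intersections of the smaller block are those of [V]. *)
Lemma ncfamily_shrink P V V' : V \notin P -> ncfamily (V |: P) ->
  V' \subset V -> V' != set0 -> V' \notin P /\ ncfamily (V' |: P).
Proof.
move=> VP ncV sV' V'0; have /set0Pn[i iV'] := V'0.
have VV : V \in V |: P by rewrite !inE eqxx.
have old X : X \in P -> X \in V |: P by rewrite !inE => ->; rewrite orbT.
have V'P : V' \notin P.
  apply: contraNN VP => V'P; suff -> : V = V' by [].
  exact: ncfamily_disjoint ncV VV (old _ V'P) (subsetP sV' _ iV') iV'.
split=> //; set f := fun X => if X == V' then V else X.
have sub X : X \in V' |: P -> f X \in V |: P /\ X \subset f X.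
  rewrite !inE /f; case: eqP => [->|_] /=; rewrite ?eqxx ?subxx // => ->.
  by rewrite orbT.
have inj X Y : X \in V' |: P -> Y \in V' |: P -> X != Y -> f X != f Y.
  rewrite !inE /f => XP YP neXY.
  case: (eqVneq X V') XP => [XE _|_ /= XP]; case: (eqVneq Y V') YP => [YE _|_ /= YP].
  - by rewrite XE YE eqxx in neXY.
  - by apply: contraNneq VP => ->.
  - by apply: contraNneq VP => <-.
  - by [].
apply/and3P; split.
- apply/trivIsetP => X Y XP YP neXY.
  have /and3P[/trivIsetP tI _ _] := ncV.
  have [[fX sX] [fY sY]] := (sub _ XP, sub _ YP).
  exact: disjointWl sX (disjointWr sY (tI _ _ fX fY (inj _ _ XP YP neXY))).
- rewrite !inE eq_sym negb_or V'0 /=; apply/negP => /old.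
  by have /and3P[_ /negP] := ncV.
have /and3P[_ _ /noncrossingP nc] := ncV.
apply/noncrossingP => X Y XP YP neXY a b c d aX bY cX dY.
have [[fX /subsetP sX] [fY /subsetP sY]] := (sub _ XP, sub _ YP).
by apply: (nc _ _ fX fY (inj _ _ XP YP neXY)); rewrite ?sX ?sY.
Qed.

End Split.

Section Collapse.
Variables (A : nzRingType) (B : {pred A}) (E : {additive A -> A}) (m : nat).
Hypothesis hE : OV_space B E.
Implicit Types (P Us : {set {set 'I_m}}) (D V W U : {set 'I_m}).
Implicit Types f : state A m.

(** Replaces the word read on each [U] in [Us] by its expectation, placed at the
    last position of [U]; the other positions of [U] are filled with [1].  The
    last position is the one next to which an adjacent block on the right would
    deposit its value. *)
Definition collapse Us f : state A m :=
  [ffun o => if o is Some i then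
     if [pick U in Us | i \in U] is Some U then
       if [forall j in U, (j <= i)%N] then E (\prod_(j in U) f (Some j)) else 1
     else f o
   else f o].

Lemma collapse_in V Us f U i : pieces V Us -> U \in Us -> i \in U ->
  collapse Us f (Some i) =
    if [forall j in U, (j <= i)%N] then E (\prod_(j in U) f (Some j)) else 1.
Proof.
move=> pUs UUs iU; rewrite ffunE; case: pickP => [X /andP[XUs iX]|/(_ U)].
  by rewrite (pieces_disjoint pUs XUs UUs iX iU).
by rewrite UUs /= iU.
Qed.

Lemma collapse_out Us f i : i \notin cover Us -> collapse Us f (Some i) = f (Some i).
Proof.
move=> niU; rewrite ffunE; case: pickP => // X /andP[XUs iX].
by case/negP: niU; apply: mem_cover iX.
Qed.

Lemma prod_collapse V Us f U : pieces V Us -> U \in Us ->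
  \prod_(i in U) collapse Us f (Some i) = E (\prod_(i in U) f (Some i)).
Proof.
move=> pUs UUs; have [_ n0 _] := pUs.
have /set0Pn[u0 u0U] : U != set0 by apply: contraNneq n0 => <-.
case: (@arg_maxnP _ u0 [in U] val u0U) => u uU umax.
rewrite (@prod_max _ _ U (fun=> 1) _ (E (\prod_(i in U) f (Some i))) u uU umax).
- by rewrite big1 ?mul1r.
- rewrite (collapse_in f pUs UUs uU) mul1r ifT //.
  by apply/forall_inP.
move=> i iU ne; rewrite (collapse_in f pUs UUs iU) ifF //; apply/negbTE.
apply: contra ne => /forall_inP/(_ u uU) ui.
by apply/eqP/val_inj/anti_leq; rewrite ui andbT; apply: umax.
Qed.

End Collapse.

Section ContractSplit.
Variables (A : nzRingType) (B : {pred A}) (E : {additive A -> A}) (m : nat).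
Hypothesis hE : OV_space B E.
Implicit Types (P Us : {set {set 'I_m}}) (D V W U : {set 'I_m}).
Implicit Types f : state A m.

Lemma cover_setU1 P V : V \notin P -> cover (V |: P) = cover P :|: V.
Proof. by move=> VP; rewrite /cover big_setU1 //= setUC. Qed.

Lemma pieces_D1 V Us U : pieces V Us -> U \in Us -> pieces (V :\: U) (Us :\ U).
Proof.
move=> pUs UUs; have [tU n0 sUV] := pUs; split.
- exact: trivIsetS (subD1set _ _) tU.
- by apply: contra n0 => /setD1P[].
move=> X /setD1P[neXU XUs]; have [/subsetP sXV itX] := sUV X XUs; split.
  apply/subsetP => i iX; rewrite inE sXV // andbT; apply: contraNN neXU => iU.
  by apply/eqP; apply: pieces_disjoint pUs XUs UUs iX iU.
exact: intervalS (subsetDl _ _) itX.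
Qed.

Lemma split_block_D1 P V Us U : V \notin P -> ncfamily (V |: P) ->
  pieces V Us -> U \in Us ->
  split_block P V Us :\ U = split_block P (V :\: U) (Us :\ U).
Proof.
move=> VP ncV pUs UUs; have [_ n0 sUV] := pUs.
have U0 : U != set0 by apply: contraNneq n0 => <-.
have [sUV1 _] := sUV U UUs.
have [UP|UP] := boolP (U \in P).
  have /set0Pn[u uU] := U0; case/negP: VP.
  suff -> : V = U by [].
  apply: (ncfamily_disjoint ncV _ _ (subsetP sUV1 _ uU) uU); rewrite !inE ?eqxx //.
  by rewrite UP orbT.
have -> : split_block P (V :\: U) (Us :\ U) =
    P :|: (Us :\ U) :|: ([set V :\: cover Us] :\ set0).
  congr (_ :|: _ :|: ([set _] :\ _)).
  by rewrite setDDl /cover [in RHS](big_setD1 U).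
apply/setP => X; rewrite !inE; have [->|//] := eqVneq X U.
rewrite (negPf UP) U0 /=; apply/esym/negbTE.
have /set0Pn[u uU] := U0; apply/eqP => /setP/(_ u).
by rewrite uU inE (mem_cover UUs uU).
Qed.

(** The parts in [Us] are removed one by one.  Removing [U] multiplies its left
    neighbour by the expectation of [U].  Inside [V] this neighbour is the last
    position of its own part, if it belongs to one, so [collapse] has the same
    effect; outside [V] it is the left neighbour of [V], and the factor comes out
    of [E] by left linearity. *)
Lemma contract_split P V Us f : V \notin P -> V != set0 -> ncfamily (V |: P) ->
  interval (cover P :|: V) V -> pieces V Us ->
  contract E #|split_block P V Us| (split_block P V Us) f =
  contract E #|P| P (step E (cover P :|: V) V (collapse E Us f)).
Proof.
have [n] := ubnP #|Us|; elim: n V Us f => // n IHn V Us f.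
move=> /ltnSE-leUs VP V0 ncV itV pUs.
have [Us0|/set0Pn[U UUs]] := eqVneq Us set0.
  have -> : collapse E Us f = f.
    apply/ffunP => -[i|]; last by rewrite ffunE.
    by rewrite collapse_out // Us0 /cover big_set0 inE.
  have -> : split_block P V Us = V |: P.
    rewrite /split_block Us0 setU0 /cover big_set0 setD0 setUC; congr (_ :|: _).
    by apply/setP => X; rewrite !inE andbC; case: eqP => // ->.
  rewrite (contract_interval hE _ ncV (setU11 _ _)) ?cover_setU1 //.
  by rewrite setU1K.
have [tU n0 sUV] := pUs; have [sUV1 itU] := sUV U UUs.
have U0 : U != set0 by apply: contraNneq n0 => <-.
have /set0Pn[u uU] := U0; have uV := subsetP sUV1 _ uU.
set D := cover P :|: V.
have dPV i : i \in cover P -> i \notin V.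
  case/bigcupP => X XP iX; apply: contraNN VP => iV.
  have -> // : V = X.
  by apply: (ncfamily_disjoint ncV _ _ iV iX); rewrite !inE ?eqxx ?XP ?orbT.
have covQ : cover (split_block P V Us) = D by apply: cover_split_block.
have UQ : U \in split_block P V Us by rewrite !inE UUs orbT.
have itDU : interval D U by apply: interval_trans itV itU.
rewrite (contract_interval hE _ (ncfamily_split VP ncV pUs) UQ) ?covQ //.
rewrite split_block_D1 //.
set C := collapse E Us f.
have CU : \prod_(i in U) C (Some i) = E (\prod_(i in U) f (Some i)).
  exact: prod_collapse pUs UUs.
have C_outV o : ~~ inside V o -> C o = f o.
  case: o => [i|_]; last by rewrite ffunE.
  move=> /= niV; apply: collapse_out; apply: contra niV => /bigcupP[X XU iX].
  by have [/subsetP sXV _] := sUV X XU; apply: sXV.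
have lD_out : ~~ inside V (left_nbr D V) by apply: left_nbr_inside.
have [V'0|V'0] := eqVneq (V :\: U) set0.
  have UV : U = V by apply/eqP; rewrite eqEsubset sUV1 -setD_eq0 V'0 eqxx.
  have Us1 : Us :\ U = set0.
    apply/setP => X; rewrite !inE; apply/negP => /andP[neXU XUs].
    have [sXV _] := sUV X XUs; have /set0Pn[i iX] : X != set0.
      by apply: contraNneq n0 => <-.
    case/eqP: neXU; apply: (pieces_disjoint pUs XUs UUs iX).
    by rewrite UV (subsetP sXV).
  have -> : split_block P (V :\: U) (Us :\ U) = P.
    rewrite /split_block Us1 setU0 V'0 set0D (_ : _ :\ _ = set0) ?setU0 //.
    by apply/setP => X; rewrite !inE andNb.
  congr (contract _ _ _ _); move: CU; rewrite UV => CU; apply/ffunP => o.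
  rewrite ffunE [RHS]ffunE CU.
  by rewrite (OV_idem hE); case: ifP => // oV; rewrite C_outV ?oV.
have [V'P ncV'] := ncfamily_shrink VP ncV (subsetDl V U) V'0.
have D' : cover P :|: (V :\: U) = D :\: U.
  apply/setP => i; rewrite !inE; have [iU|//] := boolP (i \in U).
  by rewrite /= orbF; apply/negP => /dPV; rewrite (subsetP sUV1 _ iU).
have itV' : interval (cover P :|: (V :\: U)) (V :\: U).
  rewrite D'; apply/intervalP => i j k; rewrite !inE.
  move=> /andP[_ iV] /andP[_ kV] /andP[-> jD] ij jk /=.
  by move/intervalP: itV => /(_ i j k iV kV); rewrite inE; apply.
rewrite IHn //; last 2 first.
- by rewrite -(cardS_D1 UUs).
- exact: pieces_D1.
rewrite D'; congr (contract _ _ _ _); set f' := step E D U f.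
set C' := collapse E (Us :\ U) f'.
have lV' : left_nbr (D :\: U) (V :\: U) = left_nbr D V.
  have /set0Pn[w wV'] := V'0; have [wV wU] : w \in V /\ w \notin U.
    by move: wV'; rewrite inE => /andP[].
  apply: eq_left_nbr => k; rewrite inE; apply/andP/andP => -[].
    move=> /andP[kU kD] kV'; split=> //.
    have kV : k \notin V.
      by apply/negP => kV; have /negP := before_notin kV'; rewrite inE kU.
    exact: (interval_before itV kD kV wV (beforeP _ _ kV' _ wV')).
  move=> kD kV; rewrite kD andbT; split.
    by apply: contra (before_notin kV); apply: (subsetP sUV1).
  by apply/beforeP => i; rewrite inE => /andP[_]; apply: (beforeP _ _ kV).
(* The left neighbour of U is that of V if U begins V; otherwise it lies in V. *)
have lU : left_nbr V U = None /\ left_nbr D U = left_nbr D V \/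
    exists2 l, l \in V :\: U & left_nbr V U = Some l /\ left_nbr D U = Some l.
  case eL: (left_nbr V U) / (left_nbrP V U) => [l lV lU lmax|none].
    right; exists l; first by rewrite inE lV before_notin.
    split=> //; apply: left_nbr_some => [||k kD kU] //.
      by rewrite inE lV orbT.
    have [kV|kV] := boolP (k \in V); first exact: lmax.
    rewrite leqNgt; apply/negP => lk; case/negP: kV; move/intervalP: itV.
    by move=> /(_ l k u lV uV kD lk (beforeP _ _ kU _ uU)).
  left; split=> //; apply: eq_left_nbr => k; apply/andP/andP => -[kD kU].
    split=> //; have kV : k \notin V by apply/negP => /none; rewrite kU.
    exact: (interval_before itV kD kV uV (beforeP _ _ kU _ uU)).
  by split=> //; apply/beforeP => i iU; apply: (beforeP _ _ kU); apply: (subsetP sUV1).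
have C'_outV o : ~~ inside V o -> C' o = f' o.
  case: o => [i|_]; last by rewrite ffunE.
  move=> /= niV; apply: collapse_out; apply: contra niV.
  case/bigcupP => X /setD1P[_ XU] iX.
  by have [/subsetP sXV _] := sUV X XU; apply: sXV.
suff key : f' (left_nbr D V) * E (\prod_(i in V :\: U) C' (Some i)) =
    f (left_nbr D V) * E (\prod_(i in V) C (Some i)).
  apply/ffunP => o; rewrite ffunE [RHS]ffunE lV'.
  have [oV|oV] := boolP (inside V o).
    have neo : o == left_nbr D V = false.
      by apply/eqP => ol; move: lD_out; rewrite -ol oV.
    case: ifP => // oV'; rewrite neo.
    case: o oV oV' {neo} => //= i iV; rewrite inE iV andbT => /negbFE iU.
    rewrite /C' collapse_out; first by rewrite ffunE /= iU.
    apply/negP => /bigcupP[X /setD1P[neXU XUs] iX].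
    by case/eqP: neXU; apply: pieces_disjoint pUs XUs UUs iX iU.
  have oV' : ~~ inside (V :\: U) o.
    by case: o oV => //= i iV; rewrite inE negb_and iV orbT.
  rewrite (negPf oV') C'_outV // C_outV //; have [->|neo] := eqVneq; first exact: key.
  rewrite ffunE ifF; last first.
    by case: o oV {oV' neo} => //= i; apply: contraNF; apply: (subsetP sUV1).
  case: eqP => // oU; case: lU => [[_ lD]|[l]]; first by rewrite oU lD eqxx in neo.
  by rewrite inE => /andP[_ lV] [_ lD]; rewrite oU lD /= lV in oV.
have f'E i : i \in V :\: U -> Some i != left_nbr D U -> f' (Some i) = f (Some i).
  by rewrite inE => /andP[iU _] ne; rewrite ffunE /= (negPf iU) (negPf ne).
(* If U deposits its value in another part X, it does so at the end of X. *)
have max_l l X : X \in Us :\ U -> l \in X -> left_nbr D U = Some l ->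
    forall j, j \in X -> (j <= l)%N.
  move=> /setD1P[neXU XUs] lX eL j jX; have [/subsetP sXV itX] := sUV X XUs.
  have lV := sXV _ lX; have jV := sXV _ jX.
  case: lU => [[_ lD]|[l' _ [lV1 lD]]]; first by rewrite -lD eL /= lV in lD_out.
  move: lD; rewrite eL => -[ll']; rewrite -{}ll' in lV1.
  have nXU i : i \in X -> i \in U -> False.
    by move=> iX iU; case/eqP: neXU; apply: pieces_disjoint pUs XUs UUs iX iU.
  case: left_nbrP lV1 => // l1 _ lU1 lmax [e]; rewrite e in lU1 lmax => {l1 e}.
  rewrite leqNgt; apply/negP => lj.
  have [juU|uj] := ltnP j u.
    have := lmax j jV; rewrite leqNgt lj => /(_ (interval_before itU jV _ uU juU)).
    by case: (boolP (j \in U)) => [/(nXU _ jX)//|_ /(_ isT)].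
  apply: (nXU u) => //; move/intervalP: itX => /(_ l u j lX jX uV).
  apply; first exact: (beforeP _ _ lU1).
  rewrite ltn_neqAle uj andbT; apply/eqP => /val_inj uj'.
  by apply: (nXU j); rewrite // -uj'.
have sXVU X i : X \in Us :\ U -> i \in X -> i \in V :\: U.
  by have [_ _ sP] := pieces_D1 pUs UUs => /sP[/subsetP sX _]; apply: sX.
have C'E i : i \in V :\: U -> Some i != left_nbr D U -> C' (Some i) = C (Some i).
  move=> iVU ne; have [/bigcupP[X XUs iX]|iUs] := boolP (i \in cover (Us :\ U)).
    have XUs1 : X \in Us by case/setD1P: XUs.
    rewrite (collapse_in _ _ (pieces_D1 pUs UUs) XUs iX) /C.
    rewrite (collapse_in _ _ pUs XUs1 iX); case: ifP => // /forall_inP imax.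
    congr (E _); apply: eq_bigr => j jX; rewrite f'E ?(sXVU X) //.
    apply: contraNneq ne => jl; apply/eqP; rewrite -jl; congr Some.
    by apply/val_inj/anti_leq; rewrite (imax j jX) (max_l j X).
  rewrite /C' collapse_out // f'E // /C collapse_out //.
  apply: contra iUs => /bigcupP[X XUs iX]; apply/bigcupP; exists X => //.
  rewrite !inE XUs andbT; apply: contraTneq iVU => <-.
  by rewrite inE iX.
rewrite (prod_interval _ sUV1 U0 itU) CU.
case: lU => [[-> lD]|[l lVU [-> lD]]].
  rewrite ffunE lD eqxx ifF; last first.
    rewrite -lD; apply/negbTE; apply: left_nbr_inside erefl.
  rewrite (OV_mull hE) ?(OV_in hE) // mulrA; congr (_ * E _).
  apply: eq_bigr => i iVU; apply: C'E => //; rewrite lD.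
  apply: contraNneq lD_out => <- /=; by move: iVU; rewrite inE => /andP[].
have lV : l \in V by move: lVU; rewrite inE => /andP[].
have lU1 : l \notin U by move: lVU; rewrite inE => /andP[].
have ne_l : left_nbr D V != Some l.
  by apply: contraNneq lD_out => ->.
rewrite {1}/f' ffunE lD (negPf ne_l) ifF; last first.
  apply: contraNF lD_out; case: (left_nbr D V) => //= i; exact: (subsetP sUV1).
congr (_ * E _); apply: eq_bigr => i iVU; have [->|ne] := eqVneq i l; last first.
  by rewrite C'E // lD (inj_eq Some_inj).
have f'l : f' (Some l) = f (Some l) * E (\prod_(j in U) f (Some j)).
  by rewrite ffunE /= (negPf lU1) lD eqxx.
have [/bigcupP[X XUs lX]|lUs] := boolP (l \in cover (Us :\ U)).
  have XUs1 : X \in Us by case/setD1P: XUs.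
  have lmax := max_l l X XUs lX lD.
  have lmaxb : [forall j in X, (j <= l)%N] by apply/forall_inP.
  rewrite (collapse_in _ _ (pieces_D1 pUs UUs) XUs lX) /C.
  rewrite (collapse_in _ _ pUs XUs1 lX) lmaxb.
  rewrite -(OV_mulr hE) ?(OV_in hE) //; congr (E _).
  apply: (prod_max lX lmax) => // j jX nej; apply: f'E; first exact: sXVU XUs jX.
  by rewrite lD (inj_eq Some_inj).
rewrite /C' collapse_out // f'l /C collapse_out //.
apply: contra lUs => /bigcupP[X XUs lX]; apply/bigcupP; exists X => //.
by rewrite !inE XUs andbT; apply: contraNneq lU1 => <-.
Qed.

End ContractSplit.

(** * Signed sums over subsets *)

Lemma prod_sign (A : nzRingType) (I : finType) (J : {set I}) (x y : I -> A) :
  \prod_i (if i \in J then - x i else y i) =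
  (-1) ^+ #|J| * \prod_i (if i \in J then x i else y i).
Proof.
rewrite -sum1_card big_mkcond /=.
elim: (index_enum I) => [|i s IHs]; first by rewrite !big_nil mulr1.
rewrite !big_cons IHs; case: (i \in J); rewrite ?add0n ?add1n.
  by rewrite exprS mulN1r !mulNr !mulrA (commr_sign (x i)).
by rewrite !mulrA (commr_sign (y i)).
Qed.

(** The expansion of [prod_i (y_i - x_i)], kept in order since the factors do
    not commute. *)
Lemma signed_sum_prod (A : nzRingType) (I : finType) (x y : I -> A) :
  \sum_(J : {set I}) (-1) ^+ #|J| * \prod_i (if i \in J then x i else y i) =
  \prod_i (y i - x i).
Proof.
under [RHS]eq_bigr => i _ do rewrite addrC.
by rewrite bigA_distr; apply: eq_bigr => J _; rewrite prod_sign.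
Qed.

(** The sum expands [prod_i (1 - [i in T])], which has a factor [0] unless [T] is
    empty; commutativity brings that factor to the front. *)
Lemma sum_sign_subsets_com (R : comNzRingType) (I : finType) (T : {set I}) :
  \sum_(J : {set I} | J \subset T) (-1) ^+ #|J| = (T == set0)%:R :> R.
Proof.
transitivity (\prod_(i : I) (1 - (i \in T)%:R : R)).
  rewrite -signed_sum_prod big_mkcond; apply: eq_bigr => J _.
  have [/subsetP sJT|/subsetPn[i iJ niT]] := boolP (J \subset T).
    by rewrite big1 ?mulr1 // => i _; case: ifP => // /sJT->.
  by rewrite (bigD1 i) //= iJ (negPf niT) mul0r mulr0.
have [->|/set0Pn[i iT]] := eqVneq T set0.
  by rewrite big1 // => i _; rewrite inE subr0.
by rewrite (bigD1 i) //= iT subrr mul0r.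
Qed.

Lemma sum_sign_subsets (A : nzRingType) (I : finType) (T : {set I}) :
  \sum_(J : {set I} | J \subset T) (-1) ^+ #|J| = (T == set0)%:R :> A.
Proof.
transitivity ((\sum_(J : {set I} | J \subset T) (-1) ^+ #|J| : int)%:~R : A).
  rewrite rmorph_sum; apply: eq_bigr => J _.
  by rewrite rmorphXn rmorphN1.
by rewrite sum_sign_subsets_com; case: eqP.
Qed.

(** * Maximal monochromatic runs of a block *)

Section Runs.
Variables (m : nat) (I : eqType) (col : 'I_m -> I).
Implicit Types (P : {set {set 'I_m}}) (V X : {set 'I_m}).

Definition mono X : bool := [forall x in X, forall y in X, col x == col y].

Lemma monoP X :
  reflect (forall x y, x \in X -> y \in X -> col x = col y) (mono X).
Proof.
apply: (iffP forall_inP) => [mX x y xX yX|mX x xX].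
  by apply/eqP; have /forall_inP := mX x xX; apply.
by apply/forall_inP => y yX; apply/eqP/mX.
Qed.

(** Runs and their colours are indexed by [nat] rather than by ordinals so that a
    run can be appended without casts. *)
Record runs V p (r : nat -> {set 'I_m}) (c : nat -> I) : Prop := {
  runs_cover : V = \bigcup_(j < p) r j;
  runs_neq0 : forall j, (j < p)%N -> r j != set0;
  runs_lt : forall j k, (j < k)%N -> (k < p)%N ->
    forall x y, x \in r j -> y \in r k -> (x < y)%N;
  runs_col : forall j x, (j < p)%N -> x \in r j -> col x = c j;
  runs_alt : forall j, (j.+1 < p)%N -> c j != c j.+1
}.

(** The last element of [V] either prolongs the last run of the others or starts
    a new one. *)
Lemma runs_exist V : V != set0 -> exists p r c, runs V p.+1 r c.
Proof.
have [n] := ubnP #|V|; elim: n V => // n IHn V /ltnSE-leV /set0Pn[x0 x0V].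
case: (@arg_maxnP _ x0 [in V] val x0V) => x xV xmax.
have {}xmax y : y \in V -> (y <= x)%N := xmax y.
have xlt y : y \in V :\ x -> (y < x)%N.
  move=> /setD1P[ne yV]; rewrite ltn_neqAle xmax // andbT.
  by apply: contraNneq ne => /val_inj->.
have [V'0|V'0] := eqVneq (V :\ x) set0.
  exists 0, (fun=> [set x]), (fun=> col x); split=> //.
  - by rewrite big_ord_recl big_ord0 setU0 -(setD1K xV) V'0 setU0.
  - by move=> j _; apply/set0Pn; exists x; rewrite inE.
  - by move=> j k /leq_trans le /le.
  - by move=> j y _ /set1P->.
have [|p [r [c [Vr r0 rlt rcol ralt]]]] := IHn (V :\ x) _ V'0.
  by apply: leq_trans leV; rewrite [ltnRHS](cardsD1 x) xV.
have rV j y : (j < p.+1)%N -> y \in r j -> (y < x)%N.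
  move=> jp yr; apply: xlt; rewrite Vr; apply/bigcupP.
  by exists (Ordinal jp).
have VE : V = x |: \bigcup_(j < p.+1) r j by rewrite -Vr setD1K.
have [cx|cx] := eqVneq (c p) (col x).
  exists p, (fun j => if j == p then x |: r j else r j), c; split=> //.
  - rewrite VE !big_ord_recr /= eqxx setUCA; congr (_ :|: _).
    by apply: eq_bigr => j _; rewrite ltn_eqF.
  - move=> j jp; case: (j =P p) => _; last exact: r0.
    by apply/set0Pn; exists x; rewrite !inE eqxx.
  - move=> j k jk kp y z; have jp := ltn_trans jk kp.
    rewrite (ltn_eqF (leq_trans jk kp)) => yr.
    have ltz := rlt j k jk kp y z yr; case: eqP => // kE.
    by case/setU1P => [->|//]; apply: rV yr.
  - move=> j y jp; case: eqP => [->|_]; last exact: rcol.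
    by case/setU1P => [->//|]; apply: rcol.
exists p.+1, (fun j => if j == p.+1 then [set x] else r j),
  (fun j => if j == p.+1 then col x else c j); split=> //.
- rewrite VE [RHS]big_ord_recr /= eqxx setUC; congr (_ :|: _).
  by apply: eq_bigr => j _; rewrite ltn_eqF.
- move=> j jp; case: (j =P p.+1) => [_|/eqP ne]; last first.
    by apply: r0; rewrite ltn_neqAle ne.
  by apply/set0Pn; exists x; rewrite inE.
- move=> j k jk kp y z; have jp := leq_trans jk kp.
  rewrite (ltn_eqF jp) => yr.
  case: eqP => [kE /set1P->|/eqP ne]; first exact: rV yr.
  by apply: (rlt j k) yr => //; rewrite ltn_neqAle ne.
- move=> j y jp; case: eqP => [_ /set1P->//|/eqP ne]; apply: rcol.
  by rewrite ltn_neqAle ne.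
- move=> j jp; rewrite (ltn_eqF (jp : j < p.+1)%N) eqSS.
  case: (j =P p) => [->//|/eqP ne]; apply: ralt.
  by rewrite ltnS ltn_neqAle ne.
Qed.

Section RunsTheory.
Variables (V : {set 'I_m}) (p : nat) (r : nat -> {set 'I_m}) (c : nat -> I).
Hypothesis hr : runs V p r c.

Lemma run_sub j : (j < p)%N -> r j \subset V.
Proof.
move=> jp; rewrite (runs_cover hr).
exact: (bigcup_sup (Ordinal jp)).
Qed.

Lemma mem_runs x : x \in V -> exists2 j, (j < p)%N & x \in r j.
Proof. by rewrite (runs_cover hr) => /bigcupP[[j jp] _ xr]; exists j. Qed.

Lemma run_uniq j k x : (j < p)%N -> (k < p)%N -> x \in r j -> x \in r k -> j = k.
Proof.
move=> jp kp xj xk; case: (ltngtP j k) => // [jk|kj].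
  by have := runs_lt hr jk kp xj xk; rewrite ltnn.
by have := runs_lt hr kj jp xk xj; rewrite ltnn.
Qed.

Lemma run_interval j : (j < p)%N -> interval V (r j).
Proof.
move=> jp; apply/intervalP => x z y xr zr /mem_runs[k kp yr] xy yz.
case: (ltngtP j k) => [jk|kj|->//].
  by have := ltn_trans (runs_lt hr jk kp zr yr) yz; rewrite ltnn.
by have := ltn_trans (runs_lt hr kj jp yr xr) xy; rewrite ltnn.
Qed.

Lemma run_mono j : (j < p)%N -> mono (r j).
Proof. by move=> jp; apply/monoP => x y xr yr; rewrite !(runs_col hr jp). Qed.

Lemma pieces_runs (J : {set 'I_p}) : pieces V [set r j | j : 'I_p in J].
Proof.
split.
- apply/trivIsetP => X Y /imsetP[j _ ->] /imsetP[k _ ->] ne.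
  apply/pred0P => x /=; apply/negP => /andP[xj xk].
  by case/eqP: ne; rewrite (run_uniq (ltn_ord j) (ltn_ord k) xj xk).
- by apply/negP => /imsetP[j _ r0]; have := runs_neq0 hr (ltn_ord j); rewrite -r0 eqxx.
- by move=> X /imsetP[j _ ->]; split; [apply: run_sub|apply: run_interval].
Qed.

Lemma prod_runs (A : nzRingType) (F : 'I_m -> A) :
  \prod_(i in V) F i = \prod_(j < p) \prod_(i in r j) F i.
Proof.
rewrite (runs_cover hr).
suff gen q : (q <= p)%N -> \prod_(i in \bigcup_(j < q) r j) F i =
    \prod_(j < q) \prod_(i in r j) F i by apply: gen.
elim: q => [|q IHq] qp; first by rewrite !big_ord0 big_set0.
rewrite !big_ord_recr prod_setU ?IHq //=; first exact: ltnW.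
move=> x y /bigcupP[j _ xj] yq; exact: (runs_lt hr (ltn_ord j) qp xj yq).
Qed.

(** When [Q] covers [U], this says that [U] is a union of blocks of [Q]. *)
Definition closed_under (Q : {set {set 'I_m}}) (U : {set 'I_m}) : bool :=
  [forall X in Q, (X :&: U != set0) ==> (X \subset U)].

Lemma closed_underPn (Q : {set {set 'I_m}}) (U : {set 'I_m}) :
  reflect (exists X x y, [/\ X \in Q, x \in X, x \in U, y \in X & y \notin U])
          (~~ closed_under Q U).
Proof.
apply: (iffP forall_inPn) => [[X XQ]|[X [x [y [XQ xX xU yX yU]]]]].
  rewrite negb_imply => /andP[/set0Pn[x /setIP[xX xU]] /subsetPn[y yX yU]].
  by exists X, x, y.
exists X => //; rewrite negb_imply; apply/andP; split.
  by apply/set0Pn; exists x; rewrite inE xX.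
by apply/subsetPn; exists y.
Qed.

(** If monochromatic blocks joined two runs, take two runs joined by a block at
    minimal distance.  They are not adjacent since adjacent colours differ, and
    the run right after the first one would, by minimality, be joined to a run
    outside, which forces a crossing. *)
Lemma exists_closed_run (Q : {set {set 'I_m}}) : (0 < p)%N -> noncrossing Q ->
  (forall X x, X \in Q -> x \in X -> x \in V -> X \subset V /\ mono X) ->
  exists j : 'I_p, closed_under Q (r j).
Proof.
move=> p0 /noncrossingP nc QV; apply/existsP; apply: contraT => none.
have allopen (j : 'I_p) : ~~ closed_under Q (r j).
  by apply: contra none => cj; apply/existsP; exists j.
pose linked (u : 'I_p * 'I_p) :=
  [exists X in Q, (X :&: r u.1 != set0) && (X :&: r u.2 != set0)].
have linkedP (j k : 'I_p) : reflect
    (exists X x y, [/\ X \in Q, x \in X, x \in r j, y \in X & y \in r k])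
    (linked (j, k)).
  apply: (iffP exists_inP) => [[X XQ /andP[]]|[X [x [y [XQ xX xj yX yk]]]]].
    by move=> /set0Pn[x /setIP[xX xj]] /set0Pn[y /setIP[yX yk]]; exists X, x, y.
  by exists X => //; apply/andP; split; apply/set0Pn;
     [exists x|exists y]; rewrite inE ?xX ?yX.
have linkC j k : linked (j, k) -> linked (k, j).
  by case/linkedP => X [x [y [*]]]; apply/linkedP; exists X, y, x.
have link_col (j k : 'I_p) : linked (j, k) -> c j = c k.
  case/linkedP => X [x [y [XQ xX xj yX yk]]].
  have [_ /monoP mX] := QV X x XQ xX (subsetP (run_sub (ltn_ord j)) _ xj).
  by rewrite -(runs_col hr (ltn_ord j) xj) -(runs_col hr (ltn_ord k) yk); apply: mX.
have ex_link (j : 'I_p) : exists2 k : 'I_p, k != j & linked (j, k).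
  have /closed_underPn[X [x [y [XQ xX xj yX yj]]]] := allopen j.
  have [/subsetP sXV _] := QV X x XQ xX (subsetP (run_sub (ltn_ord j)) _ xj).
  have [k kp yk] := mem_runs (sXV _ yX); exists (Ordinal kp).
    by apply: contraNneq yj => <-.
  by apply/linkedP; exists X, x, y.
have [[j0 k0] lt0] : exists u : 'I_p * 'I_p, (u.1 < u.2)%N && linked u.
  have [k] := ex_link (Ordinal p0); rewrite -val_eqE /= => ne lk.
  by exists (Ordinal p0, k); rewrite lk lt0n ne.
pose bad := [pred u : 'I_p * 'I_p | (u.1 < u.2)%N && linked u].
case: (@arg_minnP _ (j0, k0) bad (fun u => (u.2 - u.1)%N) lt0).
move=> [j k] /= /andP[jk lk] umin.
have dist a b : linked (a, b) -> (a < b)%N -> (k - j <= b - a)%N.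
  by move=> lab ab; apply: (umin (a, b)); rewrite /= ab.
have /linkedP[X [x [y [XQ xX xj yX yk]]]] := lk.
have kp := ltn_ord k; have jp1 : (j.+1 < p)%N := leq_ltn_trans jk kp.
have jk1 : (j.+1 < k)%N.
  rewrite ltn_neqAle jk andbT; apply: contraNneq (runs_alt hr jp1) => ->.
  by rewrite (link_col _ _ lk).
(* The run right after j is linked to a run l, which cannot lie within [j, k]. *)
have [l nel ll] := ex_link (Ordinal jp1).
have /linkedP[Y [x' [y' [YQ x'Y x'j y'Y y'l]]]] := ll.
have neXY : X != Y.
  apply/eqP => XY; have /eqP[] := runs_alt hr jp1.
  rewrite -(runs_col hr jp1 x'j) -(runs_col hr (ltn_ord j) xj).
  have [_ /monoP mX] := QV X x XQ xX (subsetP (run_sub (ltn_ord j)) _ xj).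
  by apply: mX => //; rewrite XY.
have xx' : (x < x')%N := runs_lt hr (ltnSn j) jp1 xj x'j.
have x'y : (x' < y)%N := runs_lt hr jk1 kp x'j yk.
case: (ltngtP l j.+1) => [lj|jl|lj]; last first.
- by case/eqP: nel; apply: val_inj.
- have := dist _ _ ll jl; rewrite /= => le.
  have kl : (k < l)%N.
    move: (le); rewrite leq_subRL ?(ltnW jl) //; apply: leq_trans.
    by rewrite addSn ltnS subnKC // ltnW.
  by case: (nc X Y XQ YQ neXY x x' y y') => //; apply: runs_lt hr _ _ kl _ _ _ yk y'l.
have := dist _ _ (linkC _ _ ll) lj; rewrite /= => le.
have lj' : (l < j)%N.
  rewrite ltn_neqAle -ltnS lj andbT; apply: contraTneq le => ->.
  by rewrite -ltnNge subSnn ltn_subRL addn1.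
have y'x : (y' < x)%N := runs_lt hr lj' (ltn_ord j) y'l xj.
have neYX : Y != X by rewrite eq_sym.
by case: (nc Y X YQ XQ neYX y' x x' y).
Qed.

End RunsTheory.

End Runs.

(** * Freeness implies that mixed cumulants vanish *)

(** The first half of [inf_free], for a single expectation. *)
Definition OV_free (A : nzRingType) (E : A -> A) (I : eqType)
    (As : I -> {pred A}) : Prop :=
  forall (m : nat) (i : 'I_m -> I) (a : 'I_m -> A),
    (1 <= m)%N ->
    (forall j k : 'I_m, k = j.+1 :> nat -> i j != i k) ->
    (forall j, a j \in As (i j)) ->
    (forall j, E (a j) = 0) ->
    E (\prod_(j < m) a j) = 0.

Section FreeRelation.
Variables (A : nzRingType) (B : {pred A}) (E : {additive A -> A}).
Variables (I : eqType) (As : I -> {pred A}).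
Hypothesis hE : OV_space B E.
Hypothesis hAs : forall k, GRing.subring_closed (As k).
Hypothesis hBAs : forall k, {subset B <= As k}.
Hypothesis hfree : OV_free E As.

Variables (m : nat) (col : 'I_m -> I).
Implicit Types (P : {set {set 'I_m}}) (V W X : {set 'I_m}) (f : state A m).

Lemma prod_closed (J : Type) (s : seq J) (Q : pred J) (F : J -> A) k :
  (forall j, Q j -> F j \in As k) -> \prod_(j <- s | Q j) F j \in As k.
Proof.
have [A1 _ AM] := hAs k.
by move=> QA; elim/big_ind: _ => // x y xA yA; apply: AM.
Qed.

Definition coloured f : Prop := forall i, f (Some i) \in As (col i).

Lemma step_coloured D V f : coloured f -> coloured (step E D V f).
Proof.
move=> fA i; rewrite ffunE; have [A1 AB AM] := hAs (col i).
case: ifP => _; first by rewrite -(subrr 1) AB.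
by case: ifP => _ //; apply: AM => //; apply/hBAs/(OV_in hE).
Qed.

(** Interval blocks other than [V] are common to all the splittings and are
    removed first.  Once [V] is an interval, [contract_split] turns each term into
    the contraction of the other blocks with [f l * E (...)] at the left neighbour
    [l] of [V]; by additivity the signed sum has there the expectation of
    [prod_j (x_j - E x_j)], an alternating product of centred elements. *)
Lemma split_relation P V f p r c :
  V \notin P -> V != set0 -> ncfamily (V |: P) -> coloured f ->
  (0 < p)%N -> runs col V p r c ->
  let Q (J : {set 'I_p}) := split_block P V [set r j | j : 'I_p in J] in
  \sum_(J : {set 'I_p}) (-1) ^+ #|J| * contract E #|Q J| (Q J) f = 0.
Proof.
have [n] := ubnP #|P|; elim: n P f => // n IHn P f /ltnSE-leP.
move=> VP V0 ncV fA p0 hr Q.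
have VV : V \in V |: P := setU11 _ _.
have VP0 : V |: P != set0 by apply/set0Pn; exists V.
have [W WVP itW] := interval_exists ncV VP0; rewrite cover_setU1 // in itW.
have covQ J : cover (Q J) = cover P :|: V.
  exact: cover_split_block (pieces_runs hr J).
have ncQ J : ncfamily (Q J) := ncfamily_split VP ncV (pieces_runs hr J).
case/setU1P: WVP => [WV|WP]; last first.
  have neWV : W != V by apply: contraNneq VP => <-.
  have W0 : W != set0 by apply: (ncfamily_set0 ncV); rewrite !inE WP orbT.
  have notsub X : X \subset V -> X != W.
    move=> /subsetP sXV; apply/eqP => XW; have /set0Pn[w wW] := W0.
    case/eqP: neWV; apply: (ncfamily_disjoint ncV _ _ wW); rewrite ?inE ?WP ?orbT //.
      by rewrite eqxx.
    by apply: sXV; rewrite XW.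
  have QW J : Q J :\ W = split_block (P :\ W) V [set r j | j : 'I_p in J].
    have [_ _ sub] := pieces_runs hr J.
    apply/setP => X; rewrite !inE; have [->|//] := eqVneq X W.
    rewrite /=; apply/esym/negbTE; rewrite negb_or; apply/andP; split.
      by apply/negP => /sub[/notsub]; rewrite eqxx.
    by rewrite W0 /= eq_sym notsub // subsetDl.
  have WQ J : W \in Q J by rewrite !inE WP.
  transitivity (\sum_(J : {set 'I_p}) (-1) ^+ #|J| *
    contract E #|Q J :\ W| (Q J :\ W) (step E (cover P :|: V) W f)).
    apply: eq_bigr => J _; congr (_ * _).
    by rewrite (contract_interval hE _ (ncQ J) (WQ J)) covQ.
  under eq_bigr => J _ do rewrite QW.
  apply: IHn => //.
  - by rewrite -(cardS_D1 WP).
  - by rewrite inE (negPf VP) andbF.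
  - by apply: ncfamilyS ncV; apply: setUS; apply: subD1set.
  - exact: step_coloured.
rewrite {W}WV in itW.
have ncP : ncfamily P by apply: ncfamilyS ncV; apply: subsetUr.
pose l := left_nbr (cover P :|: V) V.
have ll : live P l.
  rewrite /l; case: left_nbrP => //= k; rewrite inE => /orP[//|kV].
  by move=> /before_notin; rewrite kV.
pose mixed_word (J : {set 'I_p}) :=
  \prod_(j < p) (if j \in J then E (\prod_(i in r j) f (Some i))
                 else \prod_(i in r j) f (Some i)).
pose f0 := step E (cover P :|: V) V f.
have stepE (J : {set 'I_p}) :
    step E (cover P :|: V) V (collapse E [set r j | j : 'I_p in J] f) =
    upd f0 l (f l * E (mixed_word J)).
  set C := collapse _ _ _; have pJ := pieces_runs hr J.
  have -> : mixed_word J = \prod_(i in V) C (Some i).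
    rewrite (prod_runs hr); apply: eq_bigr => j _; case: ifP => jJ.
      by rewrite (prod_collapse _ _ pJ) //; apply: imset_f.
    apply: eq_bigr => i ij; rewrite /C collapse_out //.
    apply/negP => /bigcupP[X /imsetP[k kJ ->] ik].
    by rewrite (val_inj (run_uniq hr (ltn_ord j) (ltn_ord k) ij ik)) kJ in jJ.
  have nlV : ~~ inside V l := left_nbr_inside (erefl l).
  have CE o : ~~ inside V o -> C o = f o.
    case: o => [i|_]; last by rewrite ffunE.
    move=> niV; apply: collapse_out; apply: contra niV => /bigcupP[X].
    by case/imsetP => k _ -> ik; apply: (subsetP (run_sub hr (ltn_ord k))).
  apply/ffunP => o; rewrite ffunE [RHS]ffunE [f0 o]ffunE -/l.
  have [->|neo] := eqVneq o l.
    by rewrite (negPf nlV) CE.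
  by case: ifP => // oV; rewrite CE // oV.
transitivity (\sum_(J : {set 'I_p}) (-1) ^+ #|J| *
    contract E #|P| P (upd f0 l (f l * E (mixed_word J)))).
  apply: eq_bigr => J _; congr (_ * _).
  by rewrite (contract_split hE _ VP V0 ncV itW (pieces_runs hr J)) stepE.
rewrite -(contract_upd_signed_sum hE (fun J : {set 'I_p} => #|J|)) //.
suff -> : \sum_(J : {set 'I_p}) (-1) ^+ #|J| * (f l * E (mixed_word J)) = 0.
  exact: (contract_upd0 hE).
transitivity (f l * E (\sum_(J : {set 'I_p}) (-1) ^+ #|J| * mixed_word J)).
  rewrite raddf_sum mulr_sumr; apply: eq_bigr => J _.
  by rewrite raddfMsign !mulrA (commr_sign (f l)).
rewrite signed_sum_prod; set z := (X in E X).
suff -> : E z = 0 by rewrite mulr0.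
apply: (hfree (i := fun j : 'I_p => c j)) => //.
- move=> j k kj; have kp := ltn_ord k; rewrite kj in kp.
  by rewrite kj; apply: (runs_alt hr).
- move=> j; have [A1 AB AM] := hAs (c j).
  have xA : \prod_(i in r j) f (Some i) \in As (c j).
    by apply: prod_closed => i ij; rewrite -(runs_col hr (ltn_ord j) ij).
  by apply: AB => //; apply/hBAs/(OV_in hE).
- by move=> j; rewrite raddfB /= (OV_idem hE) subrr.
Qed.

End FreeRelation.

Section NCLattice.
Variable m : nat.
Implicit Types (P Q S : NC m) (V U X : {set 'I_m}) (Us : {set {set 'I_m}}).

Lemma NC_ncfamily P : ncfamily P.
Proof. by have /andP[/and3P[_ tI n0] nc] := NC_blocksP P; apply/and3P. Qed.

Lemma NC_cover P : cover P = [set: 'I_m].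
Proof. by have /andP[/and3P[/eqP]] := NC_blocksP P. Qed.

Lemma ncfamily_NC (P : {set {set 'I_m}}) :
  ncfamily P -> cover P = [set: 'I_m] -> exists S : NC m, NC_blocks S = P.
Proof.
move=> /and3P[tI n0 nc] cov.
have h : partition P [set: 'I_m] && noncrossing P.
  by rewrite /partition cov eqxx tI n0.
by exists (NCPartition h).
Qed.

Lemma NC_leP P Q :
  reflect (forall X, X \in NC_blocks P -> exists2 Y, Y \in NC_blocks Q & X \subset Y)
          (P <= Q)%O.
Proof.
by apply: (iffP forall_inP) => h X XP; [have /exists_inP := h X XP|apply/exists_inP/h].
Qed.

Lemma split_exists P V Us : V \in NC_blocks P -> pieces V Us ->
  exists S : NC m, NC_blocks S = split_block (NC_blocks P :\ V) V Us.
Proof.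
move=> VP pUs; apply: ncfamily_NC.
  by apply: ncfamily_split => //; rewrite ?setD11 // setD1K // NC_ncfamily.
by rewrite cover_split_block // -cover_setU1 ?setD11 // setD1K // NC_cover.
Qed.

(** A block of [Q] inside [V] that avoids all the parts in [Us] falls into the
    remainder. *)
Lemma le_split P Q S V Us : V \in NC_blocks P -> pieces V Us ->
  NC_blocks S = split_block (NC_blocks P :\ V) V Us ->
  (Q <= S)%O = (Q <= P)%O && [forall U in Us, closed_under (NC_blocks Q) U].
Proof.
move=> VP pUs SE; have [_ _ sUV] := pUs.
apply/NC_leP/andP => [QS|[/NC_leP QP /forall_inP cl] X XQ].
  split.
    apply/NC_leP => X /QS[Y]; rewrite SE => /split_blockP[/setD1P[_ YP]|YU|[-> _]] XY.
    - by exists Y.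
    - by exists V => //; apply: subset_trans XY _; have [] := sUV Y YU.
    - by exists V => //; apply: subset_trans XY _; apply: subsetDl.
  apply/forall_inP => U UUs; apply/forall_inP => X XQ; apply/implyP.
  case/set0Pn => x /setIP[xX xU]; have [Y YS XY] := QS X XQ.
  suff <- : Y = U by [].
  apply: (ncfamily_disjoint (NC_ncfamily S) YS _ (subsetP XY _ xX) xU).
  by rewrite SE !inE UUs orbT.
have [Y YP XY] := QP X XQ.
have [YV|neYV] := eqVneq Y V; last first.
  by exists Y => //; rewrite SE !inE neYV YP.
rewrite YV in XY.
have [/existsP[U /andP[UUs XU]]|none] :=
    boolP [exists U, (U \in Us) && (X :&: U != set0)].
  exists U; first by rewrite SE !inE UUs orbT.
  by have /forall_inP/(_ X XQ)/implyP := cl U UUs; apply.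
have XR : X \subset V :\: cover Us.
  apply/subsetP => x xX; rewrite inE (subsetP XY) // andbT.
  apply: contra none => /bigcupP[U UUs xU]; apply/existsP; exists U.
  by rewrite UUs; apply/set0Pn; exists x; rewrite inE xX.
exists (V :\: cover Us) => //; rewrite SE !inE eqxx andbT; apply/orP; right.
have /set0Pn[x xX] := ncfamily_set0 (NC_ncfamily Q) XQ.
by apply/set0Pn; exists x; apply: (subsetP XR).
Qed.

Lemma le_one_block P : (P <= one_block m)%O.
Proof.
apply/NC_leP => X XP; exists [set: 'I_m]; last exact: subsetT.
have /set0Pn[x _] := ncfamily_set0 (NC_ncfamily P) XP.
by rewrite !inE eqxx andbT; apply/set0Pn; exists x; rewrite inE.
Qed.

Lemma kappaE (A : nzRingType) (E : A -> A) (a : 'I_m -> A) :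
  kappa E a = mobius_transform (fun P : NC m => E_part E P a) (one_block m).
Proof. by apply: eq_bigl => P; rewrite le_one_block. Qed.

End NCLattice.

Section FreeImpliesVanishing.
Variables (A : nzRingType) (B : {pred A}) (E : {additive A -> A}).
Variables (I : eqType) (As : I -> {pred A}).
Hypothesis hE : OV_space B E.
Hypothesis hAs : forall k, GRing.subring_closed (As k).
Hypothesis hBAs : forall k, {subset B <= As k}.
Hypothesis hfree : OV_free E As.

Lemma E_part_contract m (P : {set {set 'I_m}}) (a : 'I_m -> A) :
  ncfamily P -> P != set0 ->
  E_part E P a = contract E #|P| P (word a).
Proof.
move=> ncP P0; rewrite -(nested_contract _ (a := a)) // ?ffunE ?mul1r //.
by move=> i _; rewrite ffunE.
Qed.

Section Fixed.
Variables (m : nat) (col : 'I_m -> I) (a : 'I_m -> A).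
Hypothesis ha : forall j, a j \in As (col j).

Let k : NC m -> A := mobius_transform (fun P : NC m => E_part E P a).

(** In [split_relation], [k Q] occurs with the sign of each set [J] of runs that
    are closed under [Q]; these signs cancel unless the empty set is the only such
    [J]. *)
Lemma sum_open_runs (P : NC m) V p r c : V \in NC_blocks P ->
  runs col V p.+1 r c ->
  \sum_(Q : NC m | (Q <= P)%O &&
      [forall j : 'I_p.+1, ~~ closed_under (NC_blocks Q) (r j)]) k Q = 0.
Proof.
move=> VP hr.
pose T (Q : NC m) := [set j : 'I_p.+1 | closed_under (NC_blocks Q) (r j)].
have V0 : V != set0 := ncfamily_set0 (NC_ncfamily P) VP.
have rel : \sum_(J : {set 'I_p.+1}) (-1) ^+ #|J| *
    \sum_(Q : NC m | (Q <= P)%O && (J \subset T Q)) k Q = 0.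
  have fA : coloured As col (word a) by move=> i; rewrite ffunE; apply: ha.
  have VD : V \notin NC_blocks P :\ V by rewrite setD11.
  have ncV : ncfamily (V |: (NC_blocks P :\ V)) by rewrite setD1K // NC_ncfamily.
  have /= rel := split_relation hE hAs hBAs hfree VD V0 ncV fA (ltn0Sn p) hr.
  rewrite -[RHS]rel.
  apply: eq_bigr => J _; congr (_ * _).
  have [S SE] := split_exists VP (pieces_runs hr J).
  have S0 : NC_blocks S != set0.
    have /set0Pn[v _] := V0; have : v \in cover S by rewrite NC_cover.
    by case/bigcupP => X XS _; apply/set0Pn; exists X.
  rewrite -SE -E_part_contract ?NC_ncfamily //.
  rewrite (mobius_inversion (fun P : NC m => E_part E P a)).
  apply: eq_bigl => Q; rewrite (le_split Q VP (pieces_runs hr J) SE).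
  congr (_ && _); apply/subsetP/forall_inP => [JT U /imsetP[j jJ ->]|cl j jJ].
    by have := JT j jJ; rewrite inE.
  by rewrite inE; apply: cl; apply: imset_f.
rewrite -[RHS]rel; under [RHS]eq_bigr => J _ do rewrite mulr_sumr.
rewrite [RHS](exchange_big_dep (fun Q : NC m => Q <= P)%O) /=; last first.
  by move=> J Q _ /andP[].
rewrite big_mkcondr; apply: eq_bigr => Q QP.
rewrite QP /= -mulr_suml sum_sign_subsets.
have -> : (T Q == set0) = [forall j : 'I_p.+1, ~~ closed_under (NC_blocks Q) (r j)].
  apply/eqP/forallP => [T0 j|cl].
    by have /setP/(_ j) := T0; rewrite !inE => ->.
  by apply/setP => j; rewrite !inE; apply/negbTE/cl.
by case: ifP => _; rewrite ?mul1r ?mul0r.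
Qed.

(** [P] has no closed run in [V], since a run is strictly smaller than the
    non-monochromatic [V].  A smaller [Q] without closed run has a
    non-monochromatic block by [exists_closed_run], so the relation
    [sum_open_runs] reduces to [k P = 0]. *)
Lemma mobius_transform_mixed (P : NC m) V :
  V \in NC_blocks P -> ~~ mono col V -> k P = 0.
Proof.
have [n] := ubnP #|[set Q : NC m | (Q < P)%O]|.
elim: n P V => // n IHn P V /ltnSE-leP VP mV.
have V0 : V != set0 := ncfamily_set0 (NC_ncfamily P) VP.
have [p [r [c hr]]] := runs_exist col V0.
have := sum_open_runs VP hr; rewrite (bigD1 P) /=; last first.
  rewrite lexx; apply/forallP => j; apply/forall_inPn; exists V => //.
  have /set0Pn[x xr] := runs_neq0 hr (ltn_ord j).
  have /subsetP sr := run_sub hr (ltn_ord j).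
  rewrite negb_imply; apply/andP; split.
    by apply/set0Pn; exists x; rewrite inE xr sr.
  apply: contra mV => /subsetP sV; apply/monoP => y z yV zV.
  by have /monoP mr := run_mono hr (ltn_ord j); apply: mr; apply: sV.
rewrite big1 ?addr0 // => Q /andP[/andP[QP open] neQP].
have ltQP : (Q < P)%O by rewrite lt_neqAle neQP.
have lt_card : (#|[set S : NC m | (S < Q)%O]| < n)%N.
  apply: leq_trans leP; apply: proper_card; apply/properP; split.
    by apply/subsetP => S; rewrite !inE => /lt_trans; apply.
  by exists Q; rewrite !inE ?ltxx.
have [/exists_inP[W WQ mW]|allmono] := boolP [exists W in NC_blocks Q, ~~ mono col W].
  exact: IHn lt_card WQ mW.
suff [j cj] : exists j : 'I_p.+1, closed_under (NC_blocks Q) (r j).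
  by have /forallP/(_ j) := open; rewrite cj.
apply: (exists_closed_run hr) => //.
  by have /and3P[] := NC_ncfamily Q.
move=> X x XQ xX xV; split; last first.
  by apply: contraNT allmono => mX; apply/exists_inP; exists X.
have /NC_leP/(_ X XQ)[Y YP XY] := QP.
suff <- : Y = V by [].
exact: ncfamily_disjoint (NC_ncfamily P) YP VP (subsetP XY _ xX) xV.
Qed.

End Fixed.

Theorem OV_free_kappa_eq0 m (i : 'I_m -> I) (a : 'I_m -> A) :
  ~ (forall j l, i j = i l) -> (forall j, a j \in As (i j)) -> kappa E a = 0.
Proof.
move=> mixed ha; rewrite kappaE.
have notmono : ~~ mono i [set: 'I_m].
  by apply/negP => /monoP mi; apply: mixed => j l; apply: mi.
apply: (mobius_transform_mixed ha (V := [set: 'I_m])) => //.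
rewrite !inE eqxx andbT; apply: contraNneq notmono => ->.
by apply/monoP => x y; rewrite inE.
Qed.

End FreeImpliesVanishing.

(** * Vanishing of mixed cumulants implies freeness *)

Section IntervalWords.
Variables (m : nat) (W : {set 'I_m}).

Lemma enum_val_lt (t u : 'I_#|W|) : (t < u)%N -> (enum_val t < enum_val u)%N.
Proof.
move=> tu; have x0 : 'I_m := enum_val t; rewrite !(enum_val_nth x0).
apply: (sorted_ltn_nth (leT := fun i j : 'I_m => (i < j)%N)) => //.
- by move=> j i k; apply: ltn_trans.
- exact: sorted_enum_ord.
- by rewrite inE -cardE.
- by rewrite inE -cardE.
Qed.

Lemma prod_enum_val (A : nzRingType) (F : 'I_m -> A) :
  \prod_(i in W) F i = \prod_(j < #|W|) F (enum_val j).
Proof.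
rewrite -prod_enum; case: (pickP (mem W)) => [x0 _|W0].
  rewrite (big_nth x0) big_mkord -cardE.
  by apply: eq_bigr => j _; rewrite (enum_val_nth x0).
have W0' : #|W| = 0 by apply: eq_card0.
rewrite (size0nil (s := enum W)) -?cardE // big_nil.
by rewrite big1 // => j; have := ltn_ord j; rewrite {2}W0'.
Qed.

(** An interval of the full ground set is a factor of the word, so that
    alternation of colours is inherited. *)
Lemma enum_val_consecutive (t u : 'I_#|W|) : interval [set: 'I_m] W ->
  u = t.+1 :> nat -> enum_val u = (enum_val t).+1 :> nat.
Proof.
move=> /intervalP itW ut; have tu : (t < u)%N by rewrite ut.
have lt := enum_val_lt tu; apply/eqP; rewrite eqn_leq lt andbT leqNgt.
apply/negP => gt; pose z := Ordinal (ltn_trans gt (ltn_ord _)).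
have zW : z \in W.
  by apply: (itW (enum_val t) z (enum_val u)); rewrite ?enum_valP ?inE /=.
have [v zE] : exists v : 'I_#|W|, z = enum_val v.
  by exists (enum_rank_in zW z); rewrite enum_rankK_in.
case: (ltngtP v t) => [/enum_val_lt|tv|/val_inj vt].
- by rewrite -zE /= ltnNge leqnSn.
- have : (u <= v)%N by rewrite ut.
  rewrite leq_eqVlt => /orP[/eqP/val_inj uv|/enum_val_lt].
    by have := gt; rewrite uv -zE /= ltnn.
  by rewrite -zE /= ltnNge ltnW.
- by have := congr1 val zE; rewrite vt /= => /eqP; rewrite gtn_eqF.
Qed.

End IntervalWords.

Section VanishingImpliesFree.
Variables (A : nzRingType) (B : {pred A}) (E : {additive A -> A}).
Variables (I : eqType) (As : I -> {pred A}).
Hypothesis hE : OV_space B E.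

Lemma E_part_one_block m (a : 'I_m.+1 -> A) :
  E_part E (one_block m.+1) a = E (\prod_(i < m.+1) a i).
Proof.
have T0 : [set: 'I_m.+1] != set0 by apply/set0Pn; exists ord0; rewrite inE.
have oE : NC_blocks (one_block m.+1) = [set [set: 'I_m.+1]].
  by apply/setP => X; rewrite !inE andbC; case: eqP => // ->.
have nc1 := NC_ncfamily (one_block m.+1); rewrite oE in nc1 *.
rewrite E_part_contract //; last first.
  by apply/set0Pn; exists [set: 'I_m.+1]; rewrite inE.
have cov : cover [set [set: 'I_m.+1]] = [set: 'I_m.+1] by rewrite /cover big_set1.
rewrite (contract_interval hE _ nc1 (set11 _)) cov; last exact: interval_self.
rewrite setDv contract_set0 ffunE /=.
have -> : left_nbr [set: 'I_m.+1] [set: 'I_m.+1] = None.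
  by case: left_nbrP => // l _ /before_notin; rewrite inE.
rewrite eqxx ffunE mul1r; congr (E _).
by apply: eq_big => [i|i _]; rewrite ?inE ?ffunE.
Qed.

(** The value of [W] becomes a factor [0] at its left neighbour, and contraction
    is additive in that coordinate. *)
Lemma E_part_eq0 m (P : NC m) (a : 'I_m -> A) W : W \in NC_blocks P ->
  interval [set: 'I_m] W -> E (\prod_(i in W) a i) = 0 -> E_part E P a = 0.
Proof.
move=> WP itW EW0; have ncP := NC_ncfamily P.
rewrite E_part_contract //; last by apply/set0Pn; exists W.
rewrite (contract_interval hE _ ncP WP) ?NC_cover //.
set f := (X in step _ _ _ X); set l := left_nbr [set: 'I_m] W.
have -> : step E [set: 'I_m] W f = upd (step E [set: 'I_m] W f) l 0.
  apply/ffunP => o; rewrite [RHS]ffunE; case: eqP => // ->; rewrite ffunE.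
  rewrite eqxx (_ : E _ = 0) ?mulr0 ?if_same // -[RHS]EW0; congr (E _).
  by apply: eq_bigr => i _; rewrite ffunE.
rewrite (contract_upd0 hE) //; first exact: ncfamilyD1.
rewrite /l; case: left_nbrP => //= i _ iW _.
by rewrite cover_D1 // NC_cover !inE before_notin.
Qed.

(** All terms of the cumulant vanish except that of the one-block partition: any
    other partition has an interval block shorter than the word, and the induction
    hypothesis applies to it. *)
Theorem kappa_eq0_OV_free :
  (forall m (i : 'I_m -> I) (a : 'I_m -> A), (2 <= m)%N ->
     ~ (forall j l, i j = i l) -> (forall j, a j \in As (i j)) ->
     kappa E a = 0) ->
  OV_free E As.
Proof.
move=> vanish m; have [n] := ubnP m; elim: n m => // n IHn [|[|m]] //.
  by move=> _ i a _ _ _ a0; rewrite big_ord1.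
move=> /ltnSE-lemn i a _ alt aA a0.
have mixed : ~ (forall j l, i j = i l).
  move=> const; have := alt ord0 (inord 1); rewrite inordK // => /(_ erefl).
  by rewrite (const ord0 (inord 1)) eqxx.
rewrite -E_part_one_block -[RHS](vanish _ _ _ _ mixed aA) //.
rewrite /kappa (bigD1 (one_block m.+2)) //= big1 => [|P neP1].
  rewrite addr0 /mobius; case: #|_| => [|k] /=; by rewrite eqxx mulr1z.
have ncP := NC_ncfamily P.
have P0 : NC_blocks P != set0.
  have : ord0 \in cover P by rewrite NC_cover inE.
  by case/bigcupP => X XP _; apply/set0Pn; exists X.
have [W WP itW] := interval_exists ncP P0; rewrite NC_cover in itW.
have W0 := ncfamily_set0 ncP WP.
rewrite (E_part_eq0 WP itW) ?mul0rz // prod_enum_val.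
apply: (IHn _ _ (fun j => i (enum_val j))) => //.
- apply: leq_trans lemn; rewrite -[X in (_ < X)%N]card_ord -cardsT.
  apply: proper_card; rewrite properT; apply: contraNneq neP1 => WT.
  apply/eqP/val_inj/eqP; rewrite eqEsubset; apply/andP; split; apply/subsetP => X.
    move=> XP; have /set0Pn[x xX] := ncfamily_set0 ncP XP.
    rewrite (ncfamily_disjoint ncP XP WP xX) ?WT ?inE // eqxx andbT.
    by rewrite -WT.
  by rewrite !inE => /andP[_ /eqP->]; move: (WP); rewrite WT.
- by rewrite card_gt0.
- by move=> j l lj; apply: alt; apply: enum_val_consecutive.
Qed.

End VanishingImpliesFree.

(** * Dual numbers *)

(** The pair [(a, a')] stands for [a + e a'] with [e] central and [e^2 = 0].  A
    separate constant is needed because pairs carry the componentwise product. *)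
Definition dual (A : nzRingType) : Type := (A * A)%type.

Section DualRing.
Variable A : nzRingType.

HB.instance Definition _ := GRing.Zmodule.copy (dual A) (A * A)%type.

Implicit Types x y z : dual A.

Definition dual_one : dual A := (1, 0).
Definition dual_mul x y : dual A := (x.1 * y.1, x.1 * y.2 + x.2 * y.1).

Lemma dual_mulA : associative dual_mul.
Proof.
by move=> x y z; rewrite /dual_mul /= !mulrDl !mulrDr !mulrA addrA.
Qed.

Lemma dual_mul1 : left_id dual_one dual_mul.
Proof. by case=> a b; rewrite /dual_mul /= !mul1r mul0r addr0. Qed.

Lemma dual_mulr1 : right_id dual_one dual_mul.
Proof. by case=> a b; rewrite /dual_mul /= !mulr1 mulr0 add0r. Qed.

Lemma dual_mulDl : left_distributive dual_mul +%R.
Proof.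
by move=> x y z; rewrite /dual_mul /= !mulrDl; congr (_, _); rewrite addrACA.
Qed.

Lemma dual_mulDr : right_distributive dual_mul +%R.
Proof.
by move=> x y z; rewrite /dual_mul /= !mulrDr; congr (_, _); rewrite addrACA.
Qed.

Lemma dual_one_neq0 : dual_one != 0.
Proof. by apply/eqP => -[/eqP]; rewrite oner_eq0. Qed.

HB.instance Definition _ := GRing.Zmodule_isNzRing.Build (dual A)
  dual_mulA dual_mul1 dual_mulr1 dual_mulDl dual_mulDr dual_one_neq0.

Definition dual_pred (S : {pred A}) : {pred dual A} :=
  [pred x : dual A | (x.1 \in S) && (x.2 \in S)].

Definition dual_fst x : A := x.1.
Definition dual_snd x : A := x.2.

Lemma dual_fst_is_additive : zmod_morphism dual_fst. Proof. by []. Qed.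
Lemma dual_snd_is_additive : zmod_morphism dual_snd. Proof. by []. Qed.

HB.instance Definition _ :=
  GRing.isZmodMorphism.Build (dual A) A dual_fst dual_fst_is_additive.
HB.instance Definition _ :=
  GRing.isZmodMorphism.Build (dual A) A dual_snd dual_snd_is_additive.

Lemma dual_subring (S : {pred A}) :
  GRing.subring_closed S -> GRing.subring_closed (dual_pred S).
Proof.
case=> S1 SB SM; have S0 : 0 \in S by rewrite -(subrr 1) SB.
have SD a b : a \in S -> b \in S -> a + b \in S.
  by move=> aS bS; rewrite -[b]opprK SB // -sub0r SB.
split=> [|x y /andP[x1 x2] /andP[y1 y2]|x y /andP[x1 x2] /andP[y1 y2]].
- by rewrite inE /= S1 S0.
- by rewrite inE /= !SB.
- by rewrite inE /= SD !SM.
Qed.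

Lemma dual_prod (T : eqType) (s : seq T) (x : T -> dual A) : uniq s ->
  \prod_(i <- s) x i =
    (\prod_(i <- s) (x i).1,
     \sum_(j <- s) \prod_(i <- s) (if i == j then (x i).2 else (x i).1)).
Proof.
elim: s => [|k s IHs] /=; first by rewrite !big_nil.
case/andP => ks us; rewrite !big_cons IHs //; congr (_, _) => /=.
rewrite eqxx addrC; congr (_ * _ + _).
  by apply: eq_big_seq => i iS; rewrite ifF //; apply: contraNF ks => /eqP<-.
rewrite mulr_sumr; apply: eq_big_seq => j jS; rewrite big_cons ifF //.
by apply: contraNF ks => /eqP->.
Qed.

Lemma dual_prod_set m (V : {set 'I_m}) (x : 'I_m -> dual A) :
  \prod_(i in V) x i =
    (\prod_(i in V) (x i).1,
     \sum_(j in V) \prod_(i in V) (if i == j then (x i).2 else (x i).1)).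
Proof.
rewrite -[LHS]prod_enum dual_prod ?enum_uniq // prod_enum big_enum /=.
by congr (_, _); apply: eq_bigr => j _; rewrite prod_enum.
Qed.

End DualRing.

Section DualExpectation.
Variables (A : nzRingType) (B : {pred A}) (E E' : {additive A -> A}).

(** [E'] is the derivative of the expectation [E + e E'], extended linearly in
    [e]. *)
Definition dual_exp (x : dual A) : dual A := (E x.1, E' x.1 + E x.2).

Lemma dual_exp_is_additive : zmod_morphism dual_exp.
Proof.
move=> x y; rewrite /dual_exp /= !raddfB; congr (_, _).
by rewrite addrACA -opprD.
Qed.

HB.instance Definition _ :=
  GRing.isZmodMorphism.Build (dual A) (dual A) dual_exp dual_exp_is_additive.

Variable m : nat.
Implicit Types (P : {set {set 'I_m}}) (V W : {set 'I_m}) (o : option 'I_m).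

Definition base_part (F : state (dual A) m) : state A m := [ffun o => (F o).1].

Definition derive_at V W : A -> A :=
  if W == V then E' : A -> A else E : A -> A.

Lemma step_fst D W (F : state (dual A) m) :
  base_part (step dual_exp D W F) = step E D W (base_part F).
Proof.
apply/ffunP => o; rewrite !ffunE; case: ifP => // _; case: ifP => // _ /=.
rewrite dual_prod_set /=; congr (_ * E _).
by apply: eq_bigr => i _; rewrite ffunE.
Qed.

(** Leibniz rule: the infinitesimal part of a nested evaluation over the dual
    numbers differentiates in turn each expectation and each entry.  One removal
    of [W] creates at the left neighbour [l] the infinitesimal part
    [a_l E'(w) + sum_(j in W) a_l E(w'_j) + a'_l E(w)], where [w'_j] is the word
    of [W] differentiated at [j].  Additivity in the coordinate [l] distributes
    these summands over the terms for the block [W], the entries of [W] and the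
    entry [l]. *)
Lemma dual_contract (hE : OV_space B E) P (F : state (dual A) m) : ncfamily P ->
  contract dual_exp #|P| P F =
    (contract E #|P| P (base_part F),
     \sum_(V in P) contract_by (derive_at V) #|P| P (base_part F) +
     \sum_(o | live P o) contract E #|P| P (upd (base_part F) o (F o).2)).
Proof.
have [n] := ubnP #|P|; elim: n P F => // n IHn P F /ltnSE-leP ncP.
have [P0|P0] := eqVneq P set0.
  rewrite P0 !contract_set0 big_set0 add0r ffunE (big_pred1 None).
    by rewrite contract_set0 ffunE eqxx -surjective_pairing.
  by case=> [i|] //=; rewrite /cover big_set0 inE.
have [W WP gE] := contract_by_pick ncP P0.
rewrite !gE IHn; [|by rewrite -cardS_D1|exact: ncfamilyD1].
rewrite step_fst; congr (_, _).
set D := cover P; set a := base_part F; set P' := P :\ W.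
set a' := step E D W a; set l := left_nbr D W.
have ncP' : ncfamily P' by apply: ncfamilyD1.
have liveE o : live P o = live P' o || inside W o.
  case: o => //= i; rewrite /P' cover_D1 // inE.
  have [iW|//] := boolP (i \in W); last by rewrite /= orbF.
  by rewrite (mem_cover WP iW).
have live_in o : live P' o -> ~~ inside W o.
  by case: o => //= i; rewrite /P' cover_D1 // inE => /andP[].
have ll : live P' l.
  rewrite /l; case: left_nbrP => //= i iD iW _.
  by rewrite /P' cover_D1 // inE iD before_notin.
pose h y := contract E #|P'| P' (upd a' l y).
have hB x y : h (x - y) = h x - h y by apply: contract_updB hE _ _ _ _ _ ncP' ll.
have h0 : h 0 = 0 by have := hB 0 0; rewrite !subrr.
have hD x y : h (x + y) = h x + h y.
  by rewrite -[y in LHS]opprK hB -[- y]sub0r hB h0 sub0r opprK.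
pose Wprod o := \prod_(i in W) upd a o (F o).2 (Some i).
have prodW : \prod_(i in W) F (Some i) =
    (\prod_(i in W) a (Some i), \sum_(j in W) Wprod (Some j)).
  rewrite dual_prod_set; congr (_, _); first by apply: eq_bigr => i _; rewrite ffunE.
  apply: eq_bigr => j _; apply: eq_bigr => i _; rewrite !ffunE (inj_eq Some_inj).
  by case: eqP => // ->.
set v := \prod_(i in W) a (Some i) in prodW.
have -> : \sum_(V in P) contract_by (derive_at V) #|P| P a =
    h (a l * E' v) + \sum_(V in P') contract_by (derive_at V) #|P'| P' a'.
  rewrite (big_setD1 W) //=; congr (_ + _).
    rewrite gE /h (contract_by_ext (psi := fun=> E)); last first.
      by move=> V /setD1P[neVW _]; rewrite /derive_at (negPf neVW).
    congr contract_by; apply/ffunP => o; rewrite /derive_at eqxx !ffunE -/l.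
    have [->|//] := eqVneq o l.
    by rewrite (negPf (left_nbr_inside (erefl l))).
  apply: eq_bigr => V /setD1P[neVW _]; rewrite gE /derive_at eq_sym.
  by rewrite (negPf neVW).
have -> : \sum_(o | live P o) contract E #|P| P (upd a o (F o).2) =
    \sum_(o | live P' o && (o != l)) contract E #|P'| P' (upd a' o (F o).2)
    + h ((F l).2 * E v) + \sum_(j in W) h (a l * E (Wprod (Some j))).
  have lW : ~~ inside W l := left_nbr_inside (erefl l).
  rewrite (bigID (inside W)) /= addrC; congr (_ + _).
    rewrite (eq_bigl (live P')) => [|o]; last first.
      rewrite liveE; case: (boolP (inside W o)) => oW; rewrite ?orbF ?andbT ?andbF //.
      by apply/esym/negbTE; apply: contraL oW; apply: live_in.
    rewrite (bigD1 l) //= addrC; congr (_ + _).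
      apply: eq_bigr => o /andP[lo neo]; rewrite gE; congr contract_by.
      have prodE : \prod_(i in W) upd a o (F o).2 (Some i) = v.
        apply: eq_bigr => i iW; rewrite ffunE ifF //.
        by apply: contraTF lo => /eqP <-; apply/negP => /live_in /=; rewrite iW.
      apply/ffunP => o'; rewrite ffunE prodE [RHS]ffunE [a' o']ffunE -/l -/v.
      rewrite ffunE; have [->|//] := eqVneq o' o.
      by rewrite (negPf (live_in _ lo)) (negPf neo).
    rewrite gE; congr contract_by.
    have prodE : \prod_(i in W) upd a l (F l).2 (Some i) = v.
      apply: eq_bigr => i iW; rewrite ffunE ifF //.
      by apply: contraNF lW => /eqP <-.
    apply/ffunP => o'; rewrite ffunE prodE [RHS]ffunE [a' o']ffunE -/l -/v.
    rewrite ffunE; have [->|//] := eqVneq o' l.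
    by rewrite (negPf lW).
  rewrite (eq_bigl (inside W)) => [|o]; last first.
    by rewrite liveE; case: (inside W o); rewrite ?orbT ?andbF.
  rewrite (reindex_omap Some id) /=; last by case.
  apply: eq_big => [j|j]; rewrite eqxx andbT // => jW; rewrite gE; congr contract_by.
  apply/ffunP => o'; rewrite ffunE [RHS]ffunE [a' o']ffunE -/l -/(Wprod (Some j)).
  have nej o : ~~ inside W o -> upd a (Some j) (F (Some j)).2 o = a o.
    by move=> oW; rewrite ffunE ifF //; apply: contraNF oW => /eqP->.
  have [->|neo] := eqVneq o' l; first by rewrite (negPf lW) nej.
  by case: ifP => // oW; rewrite nej ?oW.
rewrite [X in _ + X = _](bigD1 l) //=.
have -> : (step dual_exp D W F l).2 =
    a l * E' v + (\sum_(j in W) a l * E (Wprod (Some j)) + (F l).2 * E v).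
  rewrite ffunE (negPf (left_nbr_inside (erefl l))) eqxx prodW /= raddf_sum.
  by rewrite mulrDr mulr_sumr addrA !ffunE.
rewrite -/(h _) !hD (big_morph h hD h0) /= -/l.
rewrite (eq_bigr (fun o => contract E #|P'| P' (upd a' o (F o).2))); last first.
  move=> o /andP[lo neo]; congr contract_by; congr upd.
  by rewrite ffunE (negPf (live_in _ lo)) (negPf neo).
rewrite -!addrA [LHS]addrCA.
do 2!congr (_ + _).
by rewrite addrC -addrA [RHS]addrCA.
Qed.

(** [E'] vanishes on [B], because [E' b = b * E' 1]; this makes the extended
    expectation the identity on [B + eB]. *)
Lemma dual_OV_space : OV_space B E ->
  (forall a, E' a \in B) -> E' 1 = 0 ->
  (forall b1 a b2, b1 \in B -> b2 \in B -> E' (b1 * a * b2) = b1 * E' a * b2) ->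
  GRing.subring_closed B -> OV_space (dual_pred B) dual_exp.
Proof.
move=> hE E'B E'1 E'bimod [B1 BB BM].
have B0 : 0 \in B by rewrite -(subrr 1) BB.
have BD a b : a \in B -> b \in B -> a + b \in B.
  by move=> aB bB; rewrite -[b]opprK BB // -sub0r BB.
have E'0 b : b \in B -> E' b = 0.
  by move=> bB; have := E'bimod b 1 1 bB B1; rewrite !mulr1 E'1 mulr0.
split.
- by rewrite inE /= B1 B0.
- by move=> x; rewrite inE /= (OV_in hE) BD ?(OV_in hE).
- move=> x /andP[x1 x2]; rewrite /= /dual_exp E'0 // add0r !(OV_id hE) //.
  by case: x {x1 x2}.
move=> x y z /andP[x1 x2] /andP[z1 z2]; congr (_, _) => /=.
  exact: (OV_bimod hE).
rewrite !raddfD /= E'bimod // (OV_bimod hE) // mulrDl raddfD /=.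
rewrite !(OV_bimod hE) // !(mulrDl, mulrDr) !addrA; congr (_ + _).
by rewrite -!addrA addrCA.
Qed.

End DualExpectation.

Section DualCumulants.
Variables (A : nzRingType) (B : {pred A}) (E E' : {additive A -> A}).
Hypothesis hE : OV_space B E.

Lemma NC_neq0 m (P : NC m.+1) : NC_blocks P != set0.
Proof.
have : ord0 \in cover P by rewrite NC_cover inE.
by case/bigcupP => X XP _; apply/set0Pn; exists X.
Qed.

Lemma dual_E_part m (P : NC m.+1) (x : 'I_m.+1 -> dual A) :
  E_part (dual_exp E E') P x =
  (E_part E P (fun i => (x i).1),
   dE_part E E' P (fun i => (x i).1) +
   \sum_j E_part E P (fun i => if i == j then (x i).2 else (x i).1)).
Proof.
have ncP := NC_ncfamily P; have P0 := NC_neq0 P.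
rewrite !E_part_contract // (dual_contract _ hE) //.
have FE : base_part (word x) = word (fun i => (x i).1).
  by apply/ffunP => -[i|]; rewrite !ffunE.
rewrite FE; congr (_, _ + _).
  apply: eq_bigr => V _.
  rewrite -(nested_contract _ (a := fun i => (x i).1)) //; first by rewrite ffunE mul1r.
  by move=> i _; rewrite ffunE.
rewrite (bigD1 None) //= [X in X + _](_ : _ = 0) ?add0r; last first.
  by rewrite ffunE /=; apply: contract_upd0 hE _ _ _ ncP _.
rewrite (reindex_omap Some id) /=; last by case.
apply: eq_big => [j|j _]; first by rewrite eqxx NC_cover inE.
rewrite E_part_contract //; congr contract_by; apply/ffunP => -[i|]; rewrite !ffunE //=.
by rewrite (inj_eq Some_inj); case: eqP => // ->.
Qed.

Lemma dual_kappa m (x : 'I_m.+1 -> dual A) :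
  kappa (dual_exp E E') x =
  (kappa E (fun i => (x i).1),
   dkappa E E' (fun i => (x i).1) +
   \sum_j kappa E (fun i => if i == j then (x i).2 else (x i).1)).
Proof.
rewrite [LHS]surjective_pairing; congr (_, _).
  rewrite -/(dual_fst _) raddf_sum; apply: eq_bigr => P _.
  by rewrite raddfMz dual_E_part.
rewrite -/(dual_snd _) raddf_sum /kappa exchange_big -big_split /=.
apply: eq_bigr => P _; rewrite raddfMz dual_E_part /dual_snd /= mulrzDl.
by rewrite -mulrz_suml.
Qed.

End DualCumulants.

Section InfFreeDual.
Variables (A : nzRingType) (B : {pred A}) (E E' : {additive A -> A}).
Variables (I : eqType) (As : I -> {pred A}).
Hypothesis hE : OV_space B E.
Hypothesis hE' : forall a, E' a \in B.
Hypothesis hAs : forall k, GRing.subring_closed (As k).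
Hypothesis hBAs : forall k, {subset B <= As k}.

Definition replace_at m (a : 'I_m -> A) (j : 'I_m) y : 'I_m -> A :=
  fun i => if i == j then y else a i.

Lemma prod_replace_at m (a : 'I_m -> A) (j : 'I_m) y :
  \prod_(k < m | (k < j)%N) a k * y * \prod_(k < m | (j < k)%N) a k =
  \prod_(k < m) replace_at a j y k.
Proof.
transitivity (\prod_(k in [set: 'I_m]) replace_at a j y k); last first.
  by apply: eq_bigl => k; rewrite inE.
rewrite (prod_at _ (in_setT j)) /replace_at eqxx.
by congr (_ * _ * _); apply: eq_big => k; rewrite ?inE //= => kj;
   rewrite ifF //; apply: contraTF kj => /eqP->; rewrite ltnn.
Qed.

Lemma dual_exp_prod m (x : 'I_m -> dual A) :
  dual_exp E E' (\prod_(j < m) x j) =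
  (E (\prod_(j < m) (x j).1),
   E' (\prod_(j < m) (x j).1) +
   \sum_(j < m) E (\prod_(k < m) replace_at (fun i => (x i).1) j (x j).2 k)).
Proof.
rewrite dual_prod ?index_enum_uniq // /dual_exp /= raddf_sum.
congr (_, _ + _); apply: eq_bigr => j _; congr (E _); apply: eq_bigr => k _.
by rewrite /replace_at; case: eqP => // ->.
Qed.

Lemma prod_replace_atB m (a : 'I_m -> A) j y z :
  \prod_(k < m) replace_at a j (y - z) k =
  \prod_(k < m) replace_at a j y k - \prod_(k < m) replace_at a j z k.
Proof. by rewrite -!prod_replace_at mulrBr mulrBl. Qed.

Lemma prod_replace_atN m (a : 'I_m -> A) j y :
  \prod_(k < m) replace_at a j (- y) k = - \prod_(k < m) replace_at a j y k.
Proof. by rewrite -!prod_replace_at mulrN mulNr. Qed.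

(** From right to left, [a - e E' a] is a centred lift of a centred [a].  From
    left to right, a centred [a + e a'] satisfies [E' a = - E a'], and in an
    alternating product of centred elements one factor may be replaced by [a']
    or by [E a'] with the same expectation, since [a' - E a'] is centred. *)
Lemma inf_free_dual :
  inf_free E E' As <-> OV_free (dual_exp E E') (fun k => dual_pred (As k)).
Proof.
split=> [free m i x m0 alt xA x0|free m i a m0 alt aA a0].
  have a0 j : E (x j).1 = 0 by have [] := x0 j.
  have a0' j : E' (x j).1 = - E (x j).2.
    by have [_ /eqP] := x0 j; rewrite addr_eq0 => /eqP.
  have aA j : (x j).1 \in As (i j) by have /andP[] := xA j.
  have [E0 E'0] := free m i (fun j => (x j).1) m0 alt aA a0.
  rewrite dual_exp_prod E0 E'0 -big_split big1 //= => j _.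
  rewrite prod_replace_at a0'.
  set a := fun i => (x i).1.
  have centred : E (\prod_(k < m) replace_at a j ((x j).2 - E (x j).2) k) = 0.
    have [k|k|-> //] := free m i (replace_at a j ((x j).2 - E (x j).2)) m0 alt.
      rewrite /replace_at; case: eqP => [->|_]; last exact: aA.
      have /andP[_ xA2] := xA j.
      by have [_ AB _] := hAs (i j); apply: AB => //; apply/hBAs/(OV_in hE).
    rewrite /replace_at; case: (k == j); last exact: a0.
    by rewrite raddfB /= (OV_idem hE) subrr.
  move: centred; rewrite prod_replace_atB raddfB => /eqP; rewrite subr_eq0 => /eqP->.
  by rewrite prod_replace_atN raddfN addNr.
pose x j : dual A := (a j, - E' (a j)).
have xA j : x j \in dual_pred (As (i j)).
  have [A1 AB _] := hAs (i j); have A0 : 0 \in As (i j) by rewrite -(subrr 1) AB.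
  by rewrite inE /= aA -sub0r AB //; apply: hBAs.
have x0 j : dual_exp E E' (x j) = 0.
  rewrite /dual_exp /= a0 raddfN; congr (_, _).
  by rewrite (OV_id hE) // subrr.
have := free m i x m0 alt xA x0; rewrite dual_exp_prod => -[-> /eqP].
rewrite addr_eq0 => /eqP->; split=> //.
rewrite -sumrN; apply: eq_bigr => j _.
by rewrite prod_replace_at prod_replace_atN raddfN opprK.
Qed.

End InfFreeDual.

Theorem theorem3p6 (R : realType) (A : algType R[i]) (B : {pred A})
    (E E' : {linear A -> A}) (n : nat) (As : 'I_n -> {pred A})
    (hOVI : OVI_space B E E')
    (hAs : forall k, GRing.subalg_closed (As k))
    (hBAs : forall k, {subset B <= As k}) :
  inf_free E E' As <->
  (forall (s : nat) (i : 'I_s -> 'I_n) (a : 'I_s -> A),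
     (2 <= s)%N ->
     ~ (forall j k, i j = i k) ->
     (forall j, a j \in As (i j)) ->
     kappa E a = 0 /\ dkappa E E' a = 0).
Proof.
have subring (S : {pred A}) : GRing.subalg_closed S -> GRing.subring_closed S.
  move=> [S1 SZ SM]; split=> // x y xS yS.
  by rewrite addrC -scaleN1r; apply: SZ.
have hBr := subring B (OVI_subalg hOVI).
have hE : OV_space B E.
  by split; [case: hBr|apply: (OVI_E_in hOVI)|apply: (OVI_E_id hOVI)|
             apply: (OVI_E_bimod hOVI)].
have hAr k : GRing.subring_closed (As k) by apply: subring.
have hE' := OVI_E'_in hOVI.
have hEd : OV_space (dual_pred B) (dual_exp E E').
  exact: dual_OV_space hE hE' (OVI_E'1 hOVI) (OVI_E'_bimod hOVI) hBr.
have A0 k : 0 \in As k by have [A1 AB _] := hAr k; rewrite -(subrr 1) AB.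
apply: (iff_trans (inf_free_dual hE hE' hAr hBAs)).
split=> [free [//|s] i a s2 mixed aA|vanish].
  have hAd k := dual_subring (hAr k).
  have hBAd k : {subset dual_pred B <= dual_pred (As k)}.
    by move=> x /andP[x1 x2]; rewrite inE /= !hBAs.
  have lift (x : 'I_s.+1 -> dual A) : (forall j, x j \in dual_pred (As (i j))) ->
      kappa (dual_exp E E') x = 0 := OV_free_kappa_eq0 hEd hAd hBAd free mixed.
  have inAd b : (forall j, b j \in As (i j)) ->
      forall j, ((b j, 0) : dual A) \in dual_pred (As (i j)).
    by move=> bA j; rewrite inE /= bA A0.
  have kappa0 b : (forall j, b j \in As (i j)) -> kappa E b = 0.
    move=> /inAd/lift; rewrite (dual_kappa E' hE).
    exact: (congr1 (@dual_fst A)).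
  split; first exact: kappa0.
  have := lift _ (inAd a aA); rewrite (dual_kappa E' hE) /=.
  move=> /(congr1 (@dual_snd A)); rewrite /dual_snd /= big1 ?addr0 // => j _.
  by apply: kappa0 => l; case: eqP.
apply: (kappa_eq0_OV_free hEd) => -[//|s] i x s2 mixed xA.
rewrite (dual_kappa E' hE).
have xA1 j : (x j).1 \in As (i j) by have /andP[] := xA j.
have [-> ->] := vanish _ i (fun j => (x j).1) s2 mixed xA1.
rewrite add0r big1 // => j _; apply: (proj1 (vanish _ i _ s2 mixed _)) => l.
by case: eqP => // _; have /andP[] := xA l.
Qed.
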